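(* Let $\alpha\in(1,2]$. Let $d\mu(x)=e^{-V(x)}dx$ be a probability measure on $\mathbb R^d$ such that $V=V_0+V_1$, where $V_0$ is convex and $V_1$ is continuously differentiable. Assume that there exist a function $p\in L^1(\mu)$ and a constant $\varepsilon>0$ such that $$\exp\Big((1+\varepsilon)\big[V_1(x)-\langle x,\nabla V_1(x)\rangle+(V_1+p)^*(\nabla V_1(x))\big]\Big)\in L^1(\mu),$$ where $(V_1+p)^*$ is the Legendre transform of $V_1+p$. If for some $\eta>0$, $\int_{\mathbb R^d}\exp(\eta|x|^\alpha)\,d\mu<+\infty$, then $\mu$ satisfies Inequality $I(2/\alpha^* )$.
   Context: $\alpha^*$ is defined by $\frac1\alpha+\frac1{\alpha^*}=1$. The Legendre transform of $h:\mathbb R^d\to\mathbb R$ is $h^*(x)=\sup_{y\in\mathbb R^d}(\langle x,y\rangle-h(y))$. For $\tau\in(0,1]$, $\mu$ satisfies Inequality $I(\tau)$ if there exist constants $B,C$ such that for every smooth $f$, $\mathrm{Ent}_\mu(f^2)\le B\int f^2d\mu+C\int|\nabla f|^2\log^{1-\tau}\left(e+\frac{f^2}{\int f^2d\mu}\right)d\mu$, where $\mathrm{Ent}_\mu(f^2)=\int f^2\log\left(f^2/\int f^2d\mu\right)d\mu$. *)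

(* Defs.v *)
From HB Require Import structures.
From mathcomp Require Import all_boot all_order all_algebra.
From mathcomp Require Import all_classical all_reals all_analysis.
From mathcomp Require Import lra.

Set Implicit Arguments.
Unset Strict Implicit.
Unset Printing Implicit Defensive.

Import Order.TTheory GRing.Theory Num.Theory.
Import numFieldNormedType.Exports.

Local Open Scope classical_set_scope.
Local Open Scope ring_scope.

(* R^d is 'rV[R]_d. The library's norm on it is the sup norm, which is used
   here only for topology and differentiability; lengths use enorm below. *)

Section euclidean.
Context {R : realType} {d : nat}.
Implicit Types (x y : 'rV[R]_d) (f h : 'rV[R]_d -> R).

Definition dotprod x y : R := \sum_(i < d) x ord0 i * y ord0 i.

Definition enorm x : R := Num.sqrt (dotprod x x).

Definition partial (i : 'I_d) f x : R := 'D_(delta_mx ord0 i) f x.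

Definition grad f x : 'rV[R]_d := \row_i partial i f x.

Fixpoint continuously_differentiable (k : nat) f : Prop :=
  match k with
  | 0 => continuous f
  | k'.+1 => (forall x, differentiable f x) /\
             forall i, continuously_differentiable k' (partial i f)
  end.

Definition smooth f : Prop := forall k, continuously_differentiable k f.

Definition legendre h x : \bar R :=
  ereal_sup [set (dotprod x y - h y)%:E | y in [set: 'rV[R]_d]].

End euclidean.

(* The product sigma-algebra on 'rV[T]_n, as for n.-tuple T in the library;
   for T = R it is the Borel sigma-algebra (measurable_rV_borel). *)
Definition measure_rV_display : measure_display -> measure_display.
Proof. exact. Qed.

Section measurable_rV.
Context {dT} {T : measurableType dT}.
Variable n : nat.

Let coor : 'I_n -> 'rV[T]_n -> T := fun i x => x ord0 i.

Let rV_set0 : g_sigma_preimage coor set0.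
Proof. exact: sigma_algebra0. Qed.

Let rV_setC A : g_sigma_preimage coor A -> g_sigma_preimage coor (~` A).
Proof. exact: sigma_algebraC. Qed.

Let rV_bigcup (F : _^nat) : (forall i, g_sigma_preimage coor (F i)) ->
  g_sigma_preimage coor (\bigcup_i (F i)).
Proof. exact: sigma_algebra_bigcup. Qed.

HB.instance Definition _ := @isMeasurable.Build (measure_rV_display dT)
  'rV[T]_n (g_sigma_preimage coor) rV_set0 rV_setC rV_bigcup.

Lemma measurable_coord (i : 'I_n) :
  measurable_fun [set: 'rV[T]_n] (fun x : 'rV[T]_n => x ord0 i).
Proof.
move=> _ Y mY; rewrite setTI; apply: sub_sigma_algebra => /=.
rewrite -bigcup_seq/=; exists i => /=; first by rewrite mem_index_enum.
by exists Y => //; rewrite setTI.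
Qed.

Lemma measurable_fun_coordP d1 (T1 : measurableType d1) (f : T1 -> 'rV[T]_n) :
  (forall i, measurable_fun [set: T1] (fun x => f x ord0 i)) ->
  measurable_fun [set: T1] f.
Proof.
move=> mf.
suff sub : g_sigma_preimage coor `<=` image_set_system setT f measurable.
  by move=> _ Y mY; exact: sub.
apply: smallest_sub.
  by apply: sigma_algebra_image; exact: sigma_algebra_measurable.
move=> A; rewrite -bigcup_seq/= => -[i _ [B mB <-]].
rewrite /image_set_system/= !setTI.
by have := mf i measurableT B mB; rewrite setTI.
Qed.

End measurable_rV.

Section lebesgue_rV.
Context {R : realType}.

Definition cons_rV n (p : measurableTypeR R * 'rV[R]_n) : 'rV[R]_n.+1 :=
  \row_i oapp (fun j => p.2 ord0 j) p.1 (unlift ord0 i).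

Definition uncons_rV n (v : 'rV[R]_n.+1) : measurableTypeR R * 'rV[R]_n :=
  (v ord0 ord0, \row_j v ord0 (lift ord0 j)).

Lemma cons_rV0 n p : @cons_rV n p ord0 ord0 = p.1.
Proof. by rewrite mxE unlift_none. Qed.

Lemma cons_rVS n p i : @cons_rV n p ord0 (lift ord0 i) = p.2 ord0 i.
Proof. by rewrite mxE liftK. Qed.

Lemma cons_rVK n : cancel (@cons_rV n) (@uncons_rV n).
Proof.
case=> x v; rewrite /uncons_rV cons_rV0; congr pair.
by apply/rowP => j; rewrite mxE cons_rVS.
Qed.

Lemma measurable_cons_rV n : measurable_fun setT (@cons_rV n).
Proof.
apply: measurable_fun_coordP => i; case: (unliftP ord0 i) => [j|] ->.
  under eq_fun do rewrite cons_rVS.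
  exact: (measurableT_comp (measurable_coord j) measurable_snd).
under eq_fun do rewrite cons_rV0.
exact: measurable_fst.
Qed.

Lemma measurable_uncons_rV n : measurable_fun setT (@uncons_rV n).
Proof.
apply: measurable_fun_pair; first exact: measurable_coord.
apply: measurable_fun_coordP => i.
by under eq_fun do rewrite mxE; exact: measurable_coord.
Qed.

Section step.
Local Open Scope ereal_scope.
Variables (n : nat) (m : {sigma_finite_measure set 'rV[R]_n -> \bar R}).

Definition lebesgue_step : set 'rV[R]_n.+1 -> \bar R :=
  pushforward (@lebesgue_measure R \x m) (@cons_rV n).

Let step0 : lebesgue_step set0 = 0.
Proof. by rewrite /lebesgue_step /pushforward preimage_set0 measure0. Qed.

Let step_ge0 A : 0 <= lebesgue_step A.
Proof. by rewrite /lebesgue_step /pushforward measure_ge0. Qed.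

Let step_sigma_additive : semi_sigma_additive lebesgue_step.
Proof.
move=> F mF tF mUF; rewrite /lebesgue_step /pushforward preimage_bigcup.
have mcons A : measurable A -> measurable (@cons_rV n @^-1` A).
  by move=> mA; rewrite -[X in measurable X]setTI; exact: measurable_cons_rV.
apply: measure_semi_sigma_additive.
- by move=> k; exact: mcons.
- apply/trivIsetP => /= i j _ _ ij; rewrite -preimage_setI.
  by move/trivIsetP : tF => /(_ _ _ _ _ ij) ->//; rewrite preimage_set0.
- by rewrite -preimage_bigcup; exact: mcons.
Qed.

HB.instance Definition _ := isMeasure.Build _ _ _ lebesgue_step
  step0 step_ge0 step_sigma_additive.

Let step_sigma_finite : sigma_finite setT lebesgue_step.
Proof.
have /sigma_finiteP[F [TF ndF Foo]] := sigma_finiteT (@lebesgue_measure R).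
have /sigma_finiteP[G [TG ndG Goo]] := sigma_finiteT m.
exists (fun k => @uncons_rV n @^-1` (F k `*` G k)).
  rewrite -preimage_bigcup (_ : \bigcup_k _ = setT) ?preimage_setT//.
  apply/seteqP; split=> // -[x v] _.
  have [i _ Fx] : (\bigcup_k F k) x by rewrite -TF.
  have [j _ Gv] : (\bigcup_k G k) v by rewrite -TG.
  exists (maxn i j) => //; split => /=.
    by move: x Fx; exact/subsetPset/ndF/leq_maxl.
  by move: v Gv; exact/subsetPset/ndG/leq_maxr.
move=> k; have [mF Fk] := Foo k; have [mG Gk] := Goo k; split.
  rewrite -[X in measurable X]setTI; apply: measurable_uncons_rV => //.
  exact: measurableX.
rewrite /lebesgue_step /pushforward -comp_preimage.
rewrite (_ : _ \o _ = id); last by apply/funext => p /=; exact: cons_rVK.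
by rewrite preimage_id product_measure1E// lte_mul_pinfty// ge0_fin_numE.
Qed.

HB.instance Definition _ := @Measure_isSigmaFinite.Build _ _ _ lebesgue_step
  step_sigma_finite.

End step.

Fixpoint lebesgue_rV n : {sigma_finite_measure set 'rV[R]_n -> \bar R} :=
  match n with
  | 0 => \d_(0 : 'rV[R]_0)
  | k.+1 => lebesgue_step (lebesgue_rV k)
  end.

Lemma measurable_box n (A : 'I_n -> set R) : (forall i, measurable (A i)) ->
  measurable [set x : 'rV[R]_n | forall i, A i (x ord0 i)].
Proof.
move=> mA.
rewrite (_ : [set _ | _] =
    \bigcap_(i in [set: 'I_n]) ((fun x : 'rV[R]_n => x ord0 i) @^-1` A i)).
  apply: fin_bigcap_measurable; first exact: finite_finset.
  move=> i _; rewrite -[X in measurable X]setTI.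
  exact: (@measurable_coord _ R).
by apply/seteqP; split=> x /= Ax i; [move=> _; exact: Ax|exact: (Ax i I)].
Qed.

Lemma lebesgue_rV_box n (A : 'I_n -> set (measurableTypeR R)) :
  (forall i, measurable (A i)) ->
  lebesgue_rV n [set x | forall i, A i (x ord0 i)] =
  (\prod_(i < n) lebesgue_measure (A i))%E.
Proof.
elim: n A => [|n IH] A mA.
  by rewrite big_ord0 /= diracE mem_set//= => -[].
rewrite big_ord_recl/= /lebesgue_step /pushforward -IH//.
rewrite -product_measure1E//; last first.
  by apply: (@measurable_box n (fun j => A (lift ord0 j))) => j; exact: mA.
congr (_ _); apply/seteqP; split=> -[x v] /=.
  move=> H; split; first by have := H ord0; rewrite cons_rV0.
  by move=> i; have := H (lift ord0 i); rewrite cons_rVS.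
move=> [A0 AS] i; case: (unliftP ord0 i) => [j|] ->.
  by rewrite cons_rVS; exact: AS.
by rewrite cons_rV0.
Qed.

Lemma measurable_rV_borel n :
  (@measurable _ 'rV[R]_n) = <<s (@open 'rV[R]_n) >>.
Proof.
apply/seteqP; split.
  apply: smallest_sub; first exact: smallest_sigma_algebra.
  move=> A; rewrite -bigcup_seq/= => -[i _].
  suff : measurable_fun (setT : set (g_sigma_algebraType (@open 'rV[R]_n)))
    (fun x => x ord0 i : R).
    by move=> mi [B mB <-]; exact: mi.
  apply: (measurability _ (measurable_realfun.RGenOpens.measurableE R)).
  move=> _ [_ [a [b ->]] <-]; rewrite setTI.
  apply: sub_sigma_algebra; apply: open_comp; last exact: interval_open.
  by move=> x _; exact: coord_continuous.
apply: smallest_sub; first exact: sigma_algebra_measurable.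
move=> U oU.
pose box (q : {ffun 'I_n -> rat * rat}) : set 'rV[R]_n :=
  [set x | forall i, `]ratr (q i).1, ratr (q i).2[%classic (x ord0 i)].
rewrite (_ : U = \bigcup_q (if `[< box q `<=` U >] then box q else set0)).
  apply: countable_bigcupT_measurable; first exact: countableP.
  move=> q; case: ifP => _; last exact: measurable0.
  pose J i : set R := `]ratr (q i).1, ratr (q i).2[%classic.
  by apply: (@measurable_box n J) => i; exact: measurable_itv.
apply/seteqP; split=> [x Ux|x [q _]]; last first.
  by case: ifPn => [/asboolP sub|_ //]; exact: sub.
have /nbhs_ballP[e e0 eU] := open_nbhs_nbhs (conj oU Ux).
have e0' : 0 < e := e0.
have lo i : exists q : rat, x ord0 i - e < ratr q < x ord0 i.
  have [|q] := @rat_in_itvoo R (x ord0 i - e) (x ord0 i); first by lra.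
  by rewrite in_itv/=; exists q.
have hi i : exists q : rat, x ord0 i < ratr q < x ord0 i + e.
  have [|q] := @rat_in_itvoo R (x ord0 i) (x ord0 i + e); first by lra.
  by rewrite in_itv/=; exists q.
have /choice[f fP] := lo; have /choice[g gP] := hi.
exists [ffun i => (f i, g i)] => //.
rewrite ifT.
  by move=> i; rewrite ffunE/= in_itv/=; have := fP i; have := gP i; lra.
apply/asboolP => y By; apply: eU; split => // i j; rewrite ord1.
have := By j; rewrite ffunE /ball/= in_itv/= ltr_distlC.
by have := fP j; have := gP j; lra.
Qed.

End lebesgue_rV.

Section inequality.
Local Open Scope ereal_scope.
Context {R : realType} {d : nat}.
Variable mu : {measure set 'rV[R]_d -> \bar R}.
Implicit Types (f g : 'rV[R]_d -> R) (tau : R).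

(* If \int g dmu = 0 then g = 0 mu-a.e., and 0 * ln (0 / 0) is 0 here.
   Ent is only meaningful when g >= 0 and \int g dmu < +oo. *)
Definition Ent g : \bar R :=
  \int[mu]_x (g x * ln (g x / fine (\int[mu]_y (g y)%:E)))%:E.

(* The functions f with \int f^2 dmu = +oo are excluded: Ent(f^2) and the
   normalisation by \int f^2 dmu are undefined for them. *)
Definition inequality_I tau : Prop :=
  exists B C : R, forall f, smooth f ->
    let f2 := fun x => (f x ^+ 2)%R in
    let m := \int[mu]_x (f2 x)%:E in
    m < +oo ->
    Ent f2 <=
      B%:E * m +
      C%:E * \int[mu]_x
        (enorm (grad f x) ^+ 2 *
         (ln (expR 1 + f2 x / fine m)) `^ (1 - tau))%:E.

End inequality.

(* Main.v *)
Require Import Defs.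
From HB Require Import structures.
From mathcomp Require Import all_boot all_order all_algebra.
From mathcomp Require Import all_classical all_reals all_analysis.
From mathcomp Require Import measurable_realfun.
From mathcomp Require Import ring lra.

Set Implicit Arguments.
Unset Strict Implicit.
Unset Printing Implicit Defensive.

Import Order.TTheory GRing.Theory Num.Theory.
Import numFieldNormedType.Exports.

Local Open Scope classical_set_scope.
Local Open Scope ring_scope.

(** The proof replaces optimal transport by the Prekopa-Leindler inequality.

    Fix a box K, a C^1 function g with int_K e^g dmu = 1, and a set E of positive
    measure, contained in a fixed box and on which p is bounded by a constant N.
    Interpolate the densities e^(g - V) on K and e^(- V) on E at the point
    z = (1 - t) x + t y.  Convexity bounds the contribution of V0 by V0(z); the
    C^1 function g - V1 is expanded to first order at z; and the remaining term <grad V1(z), y> - V1(y) is at most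
    (V1 + p)^*(grad V1(z)) + N, by definition of the Legendre transform
    ([interpolation_exponent]).  Thus (1 - t)(g - V)(x) - t V(y) is at most
    (g - V)(z) + t (drift(z) - g(z) + gap(z) + N) + o(t), where gap is the
    bracket of the integrability hypothesis and drift(z) bounds
    <grad g(z), z - y> for y in E.  Prekopa-Leindler turns this pointwise bound
    into a bound on integrals ([interpolated_integral]).  Convexity of the
    exponential separates e^(t gap) from the rest at the price of replacing -g
    by -kappa g with kappa = eps / (1 + eps), and t -> 0 gives
    ([core_inequality])

      kappa int_K g e^g dmu <= const + int_K e^g drift dmu.

    This is an entropy bound for the density e^g in which the constant depends
    neither on g nor on K.

    Take e^g = (s + 1) / Z with s = f^2 / int f^2 dmu and Z a normalisation.
    Then e^g drift is of order |f| |grad f| (|x| + R0), and Young's inequality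
    with weight L^(2/alpha - 1), L = log (e + s), leaves |grad f|^2
    L^(2/alpha - 1) and s (|x| + R0)^2 L^(1 - 2/alpha).  Where (|x| + R0)^alpha
    is at most a multiple of L, the latter is at most a multiple of s L, which is
    absorbed by the entropy; elsewhere s is at most a small exponential of
    (|x| + R0)^alpha and the exponential moment controls it ([log_tradeoff],
    [young_log], [entropy_box]).  Since 1 - 2/alpha^* = 2/alpha - 1, letting K
    grow to the whole space gives the theorem. *)

(** * The one-dimensional Brunn-Minkowski inequality *)

Section lebesgue_affine.
Context {R : realType}.
Let mu := @lebesgue_measure R.

Lemma lebesgue_measure_affine (c b : R) (A : set (measurableTypeR R)) :
  0 < c -> measurable A ->
  mu A = (c%:E * mu ((fun x => c * x + b)%R @^-1` A))%E.
Proof.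
move=> c0 mA.
have mphi : measurable_fun setT
    (fun x : measurableTypeR R => (c * x + b)%R : measurableTypeR R).
  by apply: measurable_funD => //; exact: measurable_funM.
pose nu := mscale (NngNum (ltW c0))
  (measure_function_pushforward__canonical__measure_function_Measure
    (@lebesgue_measure R) mphi).
rewrite /mu (@lebesgue_measure_unique _ nu _ _ mA)// => X /ocitvP[->|[[x y]/= xy ->]].
  by rewrite !measure0.
rewrite /nu /mscale/= /pushforward (_ : _ @^-1` _ = `](x - b) / c, (y - b) / c]%classic).
  rewrite /mu lebesgue_measure_itv !lebesgue_measure_itv/= !lte_fin ltr_pM2r ?invr_gt0// ltrD2r.
  case: ifPn => _; last by rewrite mule0.
  rewrite -!EFinD -EFinM; congr (_%:E); field.
  by rewrite gt_eqF.
apply/seteqP; split=> z; rewrite /= !in_itv/= ltr_pdivrMr// ler_pdivlMr//; lra.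
Qed.

Lemma lebesgue_affine_preimage (c b : R) (A : set (measurableTypeR R)) :
  0 < c -> measurable A -> measurable ((fun x => c * x + b)%R @^-1` A).
Proof.
move=> c0 mA; rewrite -[X in measurable X]setTI.
have : measurable_fun setT (fun x : measurableTypeR R => (c * x + b)%R : measurableTypeR R).
  by apply: measurable_funD => //; exact: measurable_funM.
by apply.
Qed.

End lebesgue_affine.

Section brunn_minkowski.
Context {R : realType}.
Let mu := @lebesgue_measure R.
Variable t : R.
Hypothesis t01 : 0 < t < 1.

(** The translates (1 - t) K + t (min L) and (1 - t) (max K) + t L both lie in C
    and meet in at most one point. *)
Let compact_case (K L C : set (measurableTypeR R)) :
  compact (K : set R) -> compact (L : set R) -> K !=set0 -> L !=set0 -> measurable C ->
  (forall x y, K x -> L y -> C ((1 - t) * x + t * y)) ->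
  ((1 - t)%:E * mu K + t%:E * mu L <= mu C)%E.
Proof.
move=> cK cL K0 L0 mC KLC; have /andP[t0 t1] := t01.
have t1' : 0 < 1 - t by lra.
have mK : measurable K := compact_measurable cK.
have mL : measurable L := compact_measurable cL.
have [k /set_mem Kk kmax] : exists2 k, k \in K & forall x, x \in K -> x <= k.
  apply: (@compact_EVT_max _ R (@id R) _ K0 cK); apply: continuous_subspaceT.
  by move=> ?; exact: cvg_id.
have [l /set_mem Ll lmin] : exists2 l, l \in L & forall y, y \in L -> l <= y.
  apply: (@compact_EVT_min _ R (@id R) _ L0 cL); apply: continuous_subspaceT.
  by move=> ?; exact: cvg_id.
pose U := (fun x => (1 - t)^-1 * x + - (t * l / (1 - t)))%R @^-1` K.
pose W := (fun x => t^-1 * x + - ((1 - t) * k / t))%R @^-1` L.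
pose p := (1 - t) * k + t * l.
have mU : measurable (U : set (measurableTypeR R)).
  by apply: lebesgue_affine_preimage; rewrite ?invr_gt0.
have mW : measurable (W : set (measurableTypeR R)).
  by apply: lebesgue_affine_preimage; rewrite ?invr_gt0.
have -> : ((1 - t)%:E * mu K = mu U)%E.
  rewrite /mu (@lebesgue_measure_affine _ (1 - t)^-1 (- (t * l / (1 - t))) K) ?invr_gt0//.
  by rewrite muleA -EFinM divff ?gt_eqF// mul1e.
have -> : (t%:E * mu L = mu W)%E.
  rewrite /mu (@lebesgue_measure_affine _ t^-1 (- ((1 - t) * k / t)) L) ?invr_gt0//.
  by rewrite muleA -EFinM divff ?gt_eqF// mul1e.
have mp : measurable ([set p] : set (measurableTypeR R)) by exact: measurable_set1.
have UE : mu U = mu (U `\` [set p]).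
  rewrite {1}/mu (measureDI lebesgue_measure mU mp) [X in (_ + X)%E](_ : _ = 0%E) ?adde0//.
  apply/eqP; rewrite eq_le measure_ge0 andbT -(lebesgue_measure_set1 p).
  by apply: le_measure; rewrite ?inE//; exact: measurableI.
rewrite UE /mu -measureU//; last 2 first.
- exact: measurableD.
- rewrite -subset0 => z [[Uz zp] Wz]; apply: zp => /=.
  have zk := kmax _ (mem_set Uz); have lz := lmin _ (mem_set Wz).
  apply/eqP; rewrite eq_le /p; apply/andP; split.
    have -> : z = (1 - t) * ((1 - t)^-1 * z - t * l / (1 - t)) + t * l.
      by field; rewrite gt_eqF.
    by rewrite lerD2r ler_pM2l.
  have -> : z = (1 - t) * k + t * (t^-1 * z - (1 - t) * k / t).
    by field; rewrite gt_eqF.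
  by rewrite lerD2l ler_pM2l.
apply: le_measure; rewrite ?inE//; first by apply: measurableU => //; exact: measurableD.
move=> z [[Uz _]|Wz].
- have -> : z = (1 - t) * ((1 - t)^-1 * z - t * l / (1 - t)) + t * l.
    by field; rewrite gt_eqF.
  exact: KLC.
- have -> : z = (1 - t) * k + t * (t^-1 * z - (1 - t) * k / t).
    by field; rewrite gt_eqF.
  exact: KLC.
Qed.

(** Inner regularity reduces to compact subsets of A and B; adjoining one point
    of A and one of B makes these compact sets nonempty. *)
Lemma brunn_minkowski1 (A B C : set (measurableTypeR R)) :
  A !=set0 -> B !=set0 -> measurable A -> measurable B -> measurable C ->
  (forall x y, A x -> B y -> C ((1 - t) * x + t * y)) ->
  ((1 - t)%:E * mu A + t%:E * mu B <= mu C)%E.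
Proof.
move=> [a0 Aa0] [b0 Bb0] mA mB mC ABC; have /andP[t0 t1] := t01.
have t1' : 0 < 1 - t by lra.
have [->|Cfin] := eqVneq (mu C) +oo%E; first exact: leey.
have {}Cfin : mu C \is a fin_num by rewrite ge0_fin_numE// ltey.
suff H K L : compact (K : set R) -> K `<=` A -> compact (L : set R) -> L `<=` B ->
    ((1 - t)%:E * mu K + t%:E * mu L <= mu C)%E.
  have HA : forall L : set R, compact L -> L `<=` B ->
      ((1 - t)%:E * mu A + t%:E * mu L <= mu C)%E.
    move=> L cL LB.
    have HK K : compact (K : set R) -> K `<=` A ->
        ((1 - t)%:E * mu K + t%:E * mu L <= mu C)%E by move=> *; exact: H.
    have Lfin : (t%:E * mu L)%E \is a fin_num.
      have tL0 : (0 <= t%:E * mu L)%E by rewrite mule_ge0// lee_fin ltW.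
      rewrite ge0_fin_numE//.
      have := HK set0 compact0 (sub0set _); rewrite {1}/mu measure0 mule0 add0e.
      by move=> /le_lt_trans; apply; rewrite -ge0_fin_numE.
    rewrite -leeBrDr// -lee_pdivlMl//.
    rewrite /mu lebesgue_regularity_inner_sup//; apply: ge_ereal_sup => _ [K [cK KA] <-].
    by rewrite lee_pdivlMl// leeBrDr//; exact: HK.
  have Afin : ((1 - t)%:E * mu A)%E \is a fin_num.
    have tA0 : (0 <= (1 - t)%:E * mu A)%E by rewrite mule_ge0// lee_fin ltW.
    rewrite ge0_fin_numE//.
    have := HA set0 compact0 (sub0set _); rewrite {2}/mu measure0 mule0 adde0.
    by move=> /le_lt_trans; apply; rewrite -ge0_fin_numE.
  rewrite -leeBrDl// -lee_pdivlMl//.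
  rewrite /mu (lebesgue_regularity_inner_sup mB); apply: ge_ereal_sup => _ [L [cL LB] <-].
  by rewrite lee_pdivlMl// leeBrDl//; exact: HA.
move=> cK KA cL LB.
apply: le_trans (@compact_case (K `|` [set a0]) (L `|` [set b0]) _ _ _ _ _ mC _).
- have mK := compact_measurable cK; have mL := compact_measurable cL.
  apply: leeD; apply: lee_pmul => //; rewrite ?lee_fin ?(ltW t0) ?(ltW t1')//;
    apply: le_measure; rewrite ?inE//; try exact: subsetUl;
    by apply: measurableU => //; exact: measurable_set1.
- by apply: compactU => //; exact: compact_set1.
- by apply: compactU => //; exact: compact_set1.
- by exists a0; right.
- by exists b0; right.
- move=> x y [Kx|->] [Ly|->]; apply: ABC => //; by [exact: KA|exact: LB].
Qed.

End brunn_minkowski.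

(** * The layer-cake formula *)

Section layer_cake.
Context {d} {T : measurableType d} {R : realType}.
Variables (m : {sigma_finite_measure set T -> \bar R}) (f : T -> R).
Hypothesis mf : measurable_fun setT f.
Hypothesis f01 : forall x, 0 <= f x <= 1.

Let ind (p : T * measurableTypeR R) : \bar R := (\1_`[0%R, f p.1[ (p.2 : R))%:E.

Let measurable_ind : measurable_fun setT ind.
Proof.
apply/measurable_EFinP/measurable_indic => /=.
pose f1 (p : T * measurableTypeR R) := (0 <= (p.2 : R))%R.
pose f2 (p : T * measurableTypeR R) := ((p.2 : R) < f p.1)%R.
rewrite [X in measurable X](_ : _ =
    f1 @^-1` [set true] `&` f2 @^-1` [set true]); last first.
  by apply/seteqP; split => p; rewrite /= in_itv/= => /andP.
apply: measurableI.
- have : measurable_fun setT f1 by exact: measurable_fun_ler.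
  by move=> /(_ measurableT [set true]); rewrite setTI; exact.
- have : measurable_fun setT f2.
    by apply: measurable_fun_ltr => //; exact: measurableT_comp.
  by move=> /(_ measurableT [set true]); rewrite setTI; exact.
Qed.

Let msuperlevel r : measurable [set x | (r < f x)%R].
Proof.
rewrite -[X in measurable X]setTI (_ : [set x | _] = f @^-1` `]r, +oo[%classic).
  exact: mf.
by apply/seteqP; split=> x; rewrite /= in_itv/= andbT.
Qed.

Let ind_ge0 p : (0 <= ind p)%E. Proof. by rewrite lee_fin. Qed.

Let int_ind r : (\int[m]_x ind (x, r) =
  if (r \in `[0, 1[)%R then m [set x | (r < f x)%R] else 0)%E.
Proof.
case: ifPn => [|nr].
  rewrite in_itv/= => /andP[r0 r1].
  rewrite -[in RHS](setIT [set x | (r < f x)%R]) -integral_indic//.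
  by apply: eq_integral => x _; rewrite /ind !indicE !mem_setE/= in_itv/= r0.
apply: integral0_eq => x _; rewrite /ind indicE memNset//= in_itv/=.
move=> /andP[r0 rf]; move: nr; rewrite in_itv/= r0/= (lt_le_trans rf)//.
by have /andP[] := f01 x.
Qed.

Lemma measurable_superlevel :
  measurable_fun (`[0 : R, 1[%classic : set (measurableTypeR R))
    (fun r : measurableTypeR R => m [set x | (r < f x)%R]).
Proof.
apply: (@eq_measurable_fun _ _ _ _ _ (fun r : measurableTypeR R => \int[m]_x ind (x, r))%E).
  by move=> r /set_mem/= r01; rewrite int_ind r01.
apply: measurable_funTS.
exact: (measurable_fun_fubini_tonelli_G (m1 := m) ind measurable_ind ind_ge0).
Qed.

(** Tonelli's theorem for the indicator of 0 <= r < f x. *)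
Lemma layer_cake : (\int[m]_x (f x)%:E =
  \int[@lebesgue_measure R]_(r in `[0%R : R, 1%R[%classic) m [set x | (r < f x)%R])%E.
Proof.
transitivity (\int[m]_x \int[@lebesgue_measure R]_r ind (x, r))%E.
  apply: eq_integral => x _.
  rewrite /ind/= (integral_indic lebesgue_measure measurableT) ?setIT; last first.
    exact: (@measurable_itv R `[0, f x[).
  rewrite -[RHS]/(lebesgue_measure `[0, f x[%classic) lebesgue_measure_itv/=.
  rewrite lte_fin sube0; case: ltP => // fx0; apply/eqP; rewrite eqe.
  by rewrite eq_le fx0; have /andP[->] := f01 x.
rewrite fubini_tonelli// [RHS]integral_mkcond; apply: eq_integral => r _.
by rewrite patchE int_ind mem_setE.
Qed.

End layer_cake.

(** * The Prekopa-Leindler inequality *)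

Lemma expR_convex {R : realType} (t a b : R) : 0 <= t <= 1 ->
  expR ((1 - t) * a + t * b) <= (1 - t) * expR a + t * expR b.
Proof.
move=> /andP[t0 t1]; rewrite [X in expR X]addrC [leRHS]addrC.
exact: (convex_expR (Itv01 t0 t1) b a).
Qed.

(** This is A^(1-t) B^t <= C for 0 < t < 1.  Written through logarithms of strict
    lower bounds of A and B, it needs no convention for null or infinite values,
    and it passes to suprema of A and of B. *)
Definition geo_mean_le {R : realType} (t : R) (A B C : \bar R) : Prop :=
  forall a b : R, ((expR a)%:E < A -> (expR b)%:E < B ->
    (expR ((1 - t) * a + t * b)%R)%:E <= C)%E.

Lemma geo_mean_leS {R : realType} (t : R) (A A' B B' C C' : \bar R) :
  (A' <= A)%E -> (B' <= B)%E -> (C <= C')%E ->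
  geo_mean_le t A B C -> geo_mean_le t A' B' C'.
Proof.
move=> A'A B'B CC' h a b aA bB; apply: (le_trans _ CC').
by apply: h; [exact: lt_le_trans A'A|exact: lt_le_trans B'B].
Qed.

Section prekopa_leindler_line.
Context {R : realType}.
Let mu := @lebesgue_measure R.
Variable t : R.
Hypothesis t01 : 0 < t < 1.

(** As f and g both have supremum 1, their superlevel sets at a level r < 1 are
    both nonempty, so Brunn-Minkowski applies level by level. *)
Lemma prekopa_leindler_sup1 (f g h : measurableTypeR R -> R) :
  measurable_fun setT f -> measurable_fun setT g -> measurable_fun setT h ->
  (forall x, 0 <= f x <= 1) -> (forall x, 0 <= g x <= 1) ->
  (forall x, 0 <= h x <= 1) ->
  (forall r, r < 1 -> exists x, r < f x) ->
  (forall r, r < 1 -> exists x, r < g x) ->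
  (forall x y r, 0 <= r < 1 -> r < f x -> r < g y ->
    r < h ((1 - t) * x + t * y)) ->
  ((1 - t)%:E * \int[mu]_x (f x)%:E + t%:E * \int[mu]_x (g x)%:E <=
   \int[mu]_x (h x)%:E)%E.
Proof.
move=> mf mg mh f01 g01 h01 supf supg fgh; have /andP[t0 t1] := t01.
rewrite !layer_cake// -!ge0_integralZl//; last 4 first.
- exact: measurable_superlevel.
- by rewrite lee_fin ltW.
- exact: measurable_superlevel.
- by rewrite lee_fin subr_ge0 ltW.
have mZ (k : R) (f' : measurableTypeR R -> R) :
    measurable_fun setT f' -> (forall x, 0 <= f' x <= 1) ->
    measurable_fun (`[0 : R, 1[%classic : set (measurableTypeR R))
      (fun r : measurableTypeR R => k%:E * mu [set x | (r < f' x)%R])%E.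
  by move=> mf' f'01; apply: emeasurable_funM => //; exact: measurable_superlevel.
rewrite -ge0_integralD//; last 4 first.
- by move=> x _; rewrite mule_ge0// lee_fin subr_ge0 ltW.
- exact: mZ.
- by move=> x _; rewrite mule_ge0// lee_fin ltW.
- exact: mZ.
have msup (f' : measurableTypeR R -> R) r :
    measurable_fun setT f' -> measurable [set x | (r < f' x)%R].
  move=> mf'; rewrite -[X in measurable X]setTI.
  rewrite (_ : [set x | _] = f' @^-1` `]r, +oo[%classic); first exact: mf'.
  by apply/seteqP; split=> x; rewrite /= in_itv/= andbT.
apply: ge0_le_integral => //.
- by move=> x _; rewrite adde_ge0// mule_ge0// lee_fin ?subr_ge0 ltW.
- by apply: emeasurable_funD; exact: mZ.
- exact: measurable_superlevel.
move=> r /= /[!in_itv]/= r01; have /andP[_ r1] := r01.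
apply: (brunn_minkowski1 t01); rewrite /nonempty/=; try exact: msup.
- exact: supf.
- exact: supg.
- by move=> x y /= *; exact: fgh.
Qed.

Lemma normalising_sup (F : measurableTypeR R -> R) (N a : R) :
  (forall x, 0 <= F x <= N) -> ((expR a)%:E < \int[mu]_x (F x)%:E)%E ->
  exists alpha, (forall x, F x <= expR alpha) /\
    forall r, r < 1 -> exists x, r * expR alpha < F x.
Proof.
move=> FN aF.
have supF : has_sup (range F).
  by split; [exists (F 0), 0|exists N => _ [x _ <-]; have /andP[] := FN x].
have leF x : F x <= sup (range F) by apply: ub_le_sup; [exact: supF.2|exists x].
have s0 : 0 < sup (range F).
  rewrite ltNge; apply/negP => s0; move: aF; rewrite integral0_eq ?lte_fin.
    by rewrite ltNge expR_ge0.
  move=> x _; congr (_%:E); apply/eqP; rewrite eq_le (le_trans (leF x) s0)/=.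
  by have /andP[] := FN x.
exists (ln (sup (range F))); rewrite lnK//; split=> // r r1.
have [_ [x _ <-] Fx] : exists2 y, range F y & r * sup (range F) < y.
  by apply: sup_gt; [exact: supF.1|rewrite gtr_pMl].
by exists x.
Qed.

(** Dividing F and G by their suprema e^alpha and e^beta, and H, truncated at e^m
    with m = (1 - t) alpha + t beta, by e^m, reduces to suprema 1.  Convexity of
    the exponential then turns the arithmetic mean of the two normalised integrals
    back into a geometric one. *)
Lemma prekopa_leindler_bounded (F G : measurableTypeR R -> R)
    (H : measurableTypeR R -> \bar R) (N : R) :
  measurable_fun setT F -> measurable_fun setT G -> measurable_fun setT H ->
  (forall x, 0 <= F x <= N) -> (forall x, 0 <= G x <= N) ->
  (forall x, (0 <= H x)%E) ->
  (forall x y, geo_mean_le t (F x)%:E (G y)%:E (H ((1 - t) * x + t * y))) ->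
  geo_mean_le t (\int[mu]_x (F x)%:E) (\int[mu]_x (G x)%:E) (\int[mu]_x H x).
Proof.
move=> mF mG mH FN GN H0 FGH a b aF bG; have /andP[t0 t1] := t01.
have [alpha [Fle Fsup]] := normalising_sup FN aF.
have [beta [Gle Gsup]] := normalising_sup GN bG.
pose m := (1 - t) * alpha + t * beta.
pose h z := fine (mine (H z) (expR m)%:E) / expR m.
have hE z : ((h z)%:E * (expR m)%:E = mine (H z) (expR m)%:E)%E.
  rewrite -EFinM /h divfK ?gt_eqF ?expR_gt0// fineK// ge0_fin_numE.
    by rewrite gt_min ltry orbT.
  by rewrite le_min H0/= lee_fin expR_ge0.
have h0 z : 0 <= h z.
  rewrite divr_ge0 ?expR_ge0//; apply: fine_ge0.
  by rewrite le_min H0/= lee_fin expR_ge0.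
have mh : measurable_fun setT h.
  apply: measurable_funM => //; apply: measurableT_comp => //.
  exact: measurable_mine.
have norm01 (F' : measurableTypeR R -> R) N' g : (forall x, 0 <= F' x <= N') ->
    (forall x, F' x <= expR g) -> forall x, 0 <= F' x / expR g <= 1.
  move=> F'N F'le x; have /andP[F'0 _] := F'N x.
  by rewrite divr_ge0 ?expR_ge0//= ler_pdivrMr ?expR_gt0// mul1r.
have key := @prekopa_leindler_sup1 (fun x => F x / expR alpha)
  (fun x => G x / expR beta) h.
have {}key : (((1 - t)%:E * \int[mu]_x (F x / expR alpha)%:E +
    t%:E * \int[mu]_x (G x / expR beta)%:E <= \int[mu]_x (h x)%:E)%E).
  apply: key => //.
  - exact: measurable_funM.
  - exact: measurable_funM.
  - exact: norm01 FN Fle.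
  - exact: norm01 GN Gle.
  - move=> x; rewrite h0 -lee_fin -(@lee_pmul2r _ (expR m)%:E) ?lte_fin ?expR_gt0//.
    by rewrite hE mul1e ge_min lexx orbT.
  - move=> r r1; have [x rx] := Fsup r r1; exists x.
    by rewrite ltr_pdivlMr ?expR_gt0.
  - move=> r r1; have [x rx] := Gsup r r1; exists x.
    by rewrite ltr_pdivlMr ?expR_gt0.
  - move=> x y r /andP[r0 r1] rF rG.
    (* a level above r: it is positive even if r = 0, so it has a logarithm *)
    have [r' [rr' r'F r'G]] : exists r', [/\ r < r', r' < F x / expR alpha &
        r' < G y / expR beta].
      pose w := Num.min (F x / expR alpha) (G y / expR beta).
      have rw : r < w by rewrite lt_min rF rG.
      have wF : w <= F x / expR alpha by rewrite ge_min lexx.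
      have wG : w <= G y / expR beta by rewrite ge_min lexx orbT.
      by exists ((r + w) / 2); split; lra.
    have r'0 : 0 < r' by exact: le_lt_trans rr'.
    have r'1 : r' < 1.
      by apply: (lt_le_trans r'F); have /andP[] := norm01 _ _ _ FN Fle x.
    rewrite (lt_le_trans rr')// -lee_fin.
    rewrite -(@lee_pmul2r _ (expR m)%:E) ?lte_fin ?expR_gt0// hE.
    rewrite le_min -EFinM lee_fin ger_pMl ?expR_gt0// (ltW r'1) andbT.
    have -> : r' * expR m = expR ((1 - t) * (ln r' + alpha) + t * (ln r' + beta)).
      rewrite -[X in X * _](@lnK _ r')// -expRD; congr expR.
      by rewrite /m; ring.
    by apply: FGH; rewrite lte_fin expRD lnK// -ltr_pdivlMr ?expR_gt0.
have intZ (F' : measurableTypeR R -> R) g :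
    measurable_fun setT F' -> (forall x, 0 <= F' x <= N) ->
    (\int[mu]_x (F' x / expR g)%:E = (expR (- g))%:E * \int[mu]_x (F' x)%:E)%E.
  move=> mF' F'N; rewrite -ge0_integralZl//=; last 2 first.
  - exact/measurable_EFinP.
  - by move=> x _; rewrite lee_fin; have /andP[] := F'N x.
  by apply: eq_integral => x _; rewrite -EFinM expRN mulrC.
apply: (@le_trans _ _ ((expR m)%:E * \int[mu]_x (h x)%:E)%E); last first.
  rewrite -ge0_integralZl//=; last 2 first.
  - exact/measurable_EFinP.
  - by move=> x _; rewrite lee_fin.
  apply: ge0_le_integral => //.
  - by move=> x _; rewrite mule_ge0 ?lee_fin ?expR_ge0.
  - by apply: emeasurable_funM => //; exact/measurable_EFinP.
  - by move=> x _; rewrite muleC hE ge_min lexx.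
apply: (@le_trans _ _ ((expR m)%:E *
    ((1 - t) * expR (a - alpha) + t * expR (b - beta))%:E)%E).
  rewrite -EFinM lee_fin.
  have -> : (1 - t) * a + t * b = m + ((1 - t) * (a - alpha) + t * (b - beta)).
    by rewrite /m; ring.
  by rewrite [leLHS]expRD ler_pM2l ?expR_gt0// expR_convex// (ltW t0) ltW.
rewrite lee_wpmul2l ?lee_fin ?expR_ge0//; apply: le_trans key.
rewrite !(intZ _ _ _ _)// EFinD !EFinM.
have expRB x y : expR (x - y) = expR (- y) * expR x by rewrite -expRD addrC.
apply: leeD; apply: lee_wpmul2l; rewrite ?lee_fin ?subr_ge0 ?(ltW t0) ?(ltW t1)//.
- by rewrite expRB EFinM lee_wpmul2l ?lee_fin ?expR_ge0// ltW.
- by rewrite expRB EFinM lee_wpmul2l ?lee_fin ?expR_ge0// ltW.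
Qed.

Lemma truncation_lt (F : measurableTypeR R -> \bar R) (a : \bar R) :
  measurable_fun setT F -> (forall x, (0 <= F x)%E) -> (a < \int[mu]_x F x)%E ->
  exists n : nat, (a < \int[mu]_x (fine (mine (F x) n%:R%:E))%:E)%E.
Proof.
move=> mF F0 aF; apply/not_existsP => H.
have {}H n : (\int[mu]_x (fine (mine (F x) n%:R%:E))%:E <= a)%E.
  by rewrite leNgt; apply/negP/H.
have fineE n x : (fine (mine (F x) n%:R%:E))%:E = mine (F x) n%:R%:E.
  rewrite fineK// ge0_fin_numE; first by rewrite gt_min ltry orbT.
  by rewrite le_min F0/= lee_fin.
have lim x : mine (F x) n%:R%:E @[n --> \oo] --> F x.
  case: (F x) (F0 x) => [r||]//= r0.
    apply: cvg_near_cst; near=> n; apply/esym/eqP.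
    rewrite eq_sym; apply/eqP/min_idPl; rewrite lee_fin.
    by near: n; exact: nbhs_infty_ger.
  have -> : (fun n => mine +oo%E n%:R%:E) = (fun n => n%:R%:E) :> (nat -> \bar R).
    by apply/funext => n; apply/min_idPr; rewrite leey.
  exact/cvgeryP/cvgr_idn.
suff : (\int[mu]_x F x <= a)%E by rewrite leNgt aF.
have -> : (\int[mu]_x F x = limn (fun n => \int[mu]_x mine (F x) n%:R%:E))%E.
  rewrite -monotone_convergence//.
  - by apply: eq_integral => x _; apply/esym/cvg_lim => //; exact: lim.
  - by move=> n; exact: measurable_mine.
  - by move=> n x _; rewrite le_min F0 lee_fin ler0n.
  - move=> x _ n m nm; rewrite le_min ge_min lexx/= ge_min lee_fin ler_nat nm.
    by rewrite orbT.
apply: lime_le.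
  apply: ereal_nondecreasing_is_cvgn => n m nm; apply: ge0_le_integral => //.
  - by move=> x _; rewrite le_min F0 lee_fin ler0n.
  - exact: measurable_mine.
  - exact: measurable_mine.
  - move=> x _; rewrite le_min ge_min lexx/= ge_min lee_fin ler_nat nm.
    by rewrite orbT.
apply: nearW => n; apply: le_trans (H n).
by apply: ge0_le_integral => //= *; rewrite ?fineE//;
  [rewrite le_min F0 lee_fin ler0n|exact: measurable_mine
  |under eq_fun do rewrite fineE; exact: measurable_mine].
Unshelve. all: by end_near. Qed.

Lemma prekopa_leindler1 (F G H : measurableTypeR R -> \bar R) :
  measurable_fun setT F -> measurable_fun setT G -> measurable_fun setT H ->
  (forall x, (0 <= F x)%E) -> (forall x, (0 <= G x)%E) ->
  (forall x, (0 <= H x)%E) ->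
  (forall x y, geo_mean_le t (F x) (G y) (H ((1 - t) * x + t * y))) ->
  geo_mean_le t (\int[mu]_x F x) (\int[mu]_x G x) (\int[mu]_x H x).
Proof.
move=> mF mG mH F0 G0 H0 FGH a b aF bG.
have [n {}aF] := truncation_lt mF F0 aF; have [p {}bG] := truncation_lt mG G0 bG.
have bnd (F' : measurableTypeR R -> \bar R) k : (forall x, (0 <= F' x)%E) ->
    forall x, (fine (mine (F' x) k%:R%:E))%:E = mine (F' x) k%:R%:E.
  move=> F'0 x; rewrite fineK// ge0_fin_numE; first by rewrite gt_min ltry orbT.
  by rewrite le_min F'0/= lee_fin.
have bnd2 (F' : measurableTypeR R -> \bar R) k : (forall x, (0 <= F' x)%E) ->
    (k <= maxn n p)%N ->
    forall x, 0 <= fine (mine (F' x) k%:R%:E) <= (maxn n p)%:R.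
  move=> F'0 kn x; rewrite -!lee_fin bnd// le_min F'0 ge_min !lee_fin ler0n/=.
  by rewrite ler_nat kn orbT.
apply: prekopa_leindler_bounded aF bG => //.
- by apply: measurableT_comp => //; exact: measurable_mine.
- by apply: measurableT_comp => //; exact: measurable_mine.
- exact: bnd2 (leq_maxl _ _).
- exact: bnd2 (leq_maxr _ _).
- by move=> x y; apply: geo_mean_leS (FGH x y) => //; rewrite bnd// ge_min lexx.
Qed.

End prekopa_leindler_line.

Section prekopa_leindler.
Context {R : realType}.

Lemma integral_lebesgue_rVS n (F : 'rV[R]_n.+1 -> \bar R) :
  measurable_fun setT F -> (forall x, (0 <= F x)%E) ->
  (\int[lebesgue_rV n.+1]_x F x =
   \int[@lebesgue_measure R]_x \int[lebesgue_rV n]_v F (cons_rV (x, v)))%E.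
Proof.
move=> mF F0; rewrite /= /lebesgue_step.
rewrite (ge0_integral_pushforward (@measurable_cons_rV R n))//.
rewrite preimage_setT fubini_tonelli1//.
  by apply: measurableT_comp => //; exact: measurable_cons_rV.
by move=> x /=; exact: F0.
Qed.

(** Induction on the dimension: by the induction hypothesis on slices, the
    integrals of F, G and H over all coordinates but the first satisfy the
    hypothesis of the one-dimensional inequality. *)
Lemma prekopa_leindler (t : R) n (F G H : 'rV[R]_n -> \bar R) :
  0 < t < 1 ->
  measurable_fun setT F -> measurable_fun setT G -> measurable_fun setT H ->
  (forall x, (0 <= F x)%E) -> (forall x, (0 <= G x)%E) ->
  (forall x, (0 <= H x)%E) ->
  (forall x y, geo_mean_le t (F x) (G y) (H ((1 - t) *: x + t *: y))) ->
  geo_mean_le t (\int[lebesgue_rV n]_x F x) (\int[lebesgue_rV n]_x G x)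
                (\int[lebesgue_rV n]_x H x).
Proof.
move=> t01; elim: n F G H => [|n IH] F G H mF mG mH F0 G0 H0 FGH.
  rewrite /= !integral_dirac// !diracT !mul1e.
  by have := FGH 0 0; rewrite !scaler0 addr0.
have mcons (K : 'rV[R]_n.+1 -> \bar R) : measurable_fun setT K ->
    measurable_fun setT (K \o @cons_rV R n).
  by move=> mK; apply: measurableT_comp => //; exact: measurable_cons_rV.
have mslice (K : 'rV[R]_n.+1 -> \bar R) x : measurable_fun setT K ->
    measurable_fun setT (fun v => K (cons_rV (x, v))).
  move=> mK; apply: (measurableT_comp (mcons _ mK)).
  exact: measurable_pair1.
have mint (K : 'rV[R]_n.+1 -> \bar R) : measurable_fun setT K ->
    (forall x, (0 <= K x)%E) ->
    measurable_fun setT (fun x => \int[lebesgue_rV n]_v K (cons_rV (x, v)))%E.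
  move=> mK K0.
  by apply: (measurable_fun_fubini_tonelli_F (m2 := lebesgue_rV n)
    (K \o @cons_rV R n)); [exact: mcons|move=> x; exact: K0].
rewrite !integral_lebesgue_rVS//.
apply: (@prekopa_leindler1 R t t01) => //; try exact: mint.
- by move=> x; exact: integral_ge0.
- by move=> x; exact: integral_ge0.
- by move=> x; exact: integral_ge0.
move=> x y; apply: IH => //; try exact: mslice.
move=> v w.
suff -> : cons_rV ((1 - t) * x + t * y, (1 - t) *: v + t *: w) =
  (1 - t) *: cons_rV (x, v) + t *: cons_rV (y, w) by exact: FGH.
apply/rowP => i; rewrite !mxE; case: (unliftP ord0 i) => [j|] _ /=.
  by rewrite !mxE.
by [].
Qed.

End prekopa_leindler.

(** * Measures with a density, and measurability of convex functions *)

Section density.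
Local Open Scope ereal_scope.
Context {d} {T : measurableType d} {R : realType}.
Variables (m nu : {measure set T -> \bar R}) (w : T -> R).
Hypotheses (mw : measurable_fun setT w) (w0 : forall x, (0 <= w x)%R).
Hypothesis nuE : forall A, measurable A -> nu A = \int[m]_(x in A) (w x)%:E.

Import HBNNSimple.

Lemma ge0_integral_density (f : T -> \bar R) :
  measurable_fun setT f -> (forall x, 0 <= f x) ->
  \int[nu]_x f x = \int[m]_x (f x * (w x)%:E).
Proof.
move=> mf f0; pose f_ := nnsfun_approx measurableT mf.
have f_f x : (f_ n x)%:E @[n --> \oo] --> f x.
  by apply: cvg_nnsfun_approx => // *; exact: f0.
transitivity (limn (fun n => \int[nu]_x (f_ n x)%:E)).
  rewrite -monotone_convergence//.
  - by apply: eq_integral => y _; apply/esym/cvg_lim => //; exact: f_f.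
  - by move=> n; exact/measurable_EFinP/measurable_funP.
  - by move=> n y _; rewrite lee_fin.
  - by move=> y _ k n kn; rewrite lee_fin; exact/lefP/nd_nnsfun_approx.
transitivity (limn (fun n => \int[m]_x ((f_ n x)%:E * (w x)%:E))); last first.
  rewrite -monotone_convergence//.
  - apply: eq_integral => y _; apply/cvg_lim => //.
    by apply: cvgeZr => //; exact: f_f.
  - by move=> n; apply: emeasurable_funM; apply/measurable_EFinP => //; exact: measurable_funP.
  - by move=> n y _; rewrite mule_ge0// lee_fin.
  - move=> y _ k n kn; rewrite lee_wpmul2r// lee_fin//.
    exact/lefP/nd_nnsfun_approx.
apply/congr_lim/funext => n.
rewrite integralT_nnsfun sintegralE.
transitivity (\sum_(k \in range (f_ n))
    \int[m]_x ((k * \1_(f_ n @^-1` [set k]) x)%:E * (w x)%:E)).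
  apply: eq_fsbigr => r _.
  have [r0|r0] := ltP r 0%R.
    rewrite preimage_nnfun0// measure0 mule0 integral0_eq// => x _.
    by rewrite indic0 mulr0 mul0e.
  rewrite nuE// integral_mkcond -ge0_integralZl//; last 2 first.
  - apply/(measurable_restrictT _ _).1 => //; apply: measurable_funTS; exact/measurable_EFinP.
  - by move=> x _; apply: erestrict_ge0 => y _; rewrite lee_fin.
  apply: eq_integral => x _; rewrite patchE indicE; case: ifPn => _.
    by rewrite mulr1.
  by rewrite mule0 mulr0 mul0e.
rewrite -ge0_integral_fsum//.
- apply: eq_integral => x _; rewrite -ge0_mule_fsuml.
    by rewrite fsumEFin// -fimfunE.
  by move=> r; exact: nnfun_muleindic_ge0.
- by move=> r; apply: emeasurable_funM; apply/measurable_EFinP => //; exact: measurable_funM.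
- by move=> r x _; apply: mule_ge0; [rewrite EFinM; exact: nnfun_muleindic_ge0|rewrite lee_fin].
Qed.

End density.

Section measurability.
Context {R : realType} {n : nat}.

Lemma open_measurable_rV (U : set 'rV[R]_n) : open U -> measurable U.
Proof. by move=> oU; rewrite measurable_rV_borel; exact: sub_sigma_algebra. Qed.

Lemma usc_measurable_rV (f : 'rV[R]_n -> R) :
  (forall c, open [set x | f x < c]) -> measurable_fun setT f.
Proof.
move=> of_; apply: (measurability _ (RGenInftyO.measurableE R)).
move=> _ [_ [c ->] <-]; rewrite setTI; apply: open_measurable_rV.
by rewrite set_itvE; exact: of_.
Qed.

Lemma continuous_measurable_rV (f : 'rV[R]_n -> R) :
  continuous f -> measurable_fun setT f.
Proof.
move=> cf; apply: usc_measurable_rV => c.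
rewrite (_ : [set x | _] = f @^-1` [set y | y < c])//.
by apply: open_comp => [x _|]; [exact: cf|exact: open_lt].
Qed.

End measurability.

Section convex.
Context {R : realType} {n : nat}.
Variable V0 : 'rV[R]_n -> R.
Hypothesis hV0 : convex_function [set: convex_lmodType 'rV[R]_n] V0.

Lemma convex_functionE (t : R) x y : 0 <= t <= 1 ->
  V0 ((1 - t) *: x + t *: y) <= (1 - t) * V0 x + t * V0 y.
Proof.
move=> /andP[t0 t1]; rewrite [X in V0 X]addrC [leRHS]addrC.
by apply: (hV0 (Itv01 t0 t1)); rewrite inE.
Qed.

Let e i : 'rV[R]_n := delta_mx ord0 i.

(** A midpoint-closed set that contains long enough segments of the coordinate
    axes contains a box: splitting off one coordinate as a midpoint doubles the
    vectors, hence the factor 2 ^+ size s. *)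
Let in_cross_polytope (C : set 'rV[R]_n) (s : seq 'I_n) (r : R) (z : 'I_n -> R) :
  C 0 -> (forall u v, C u -> C v -> C (2^-1 *: u + 2^-1 *: v)) ->
  (forall i a, `|a| <= 2 ^+ size s * r -> C (a *: e i)) ->
  (forall i, `|z i| <= r) -> C (\sum_(i <- s) z i *: e i).
Proof.
move=> C0 Cmid; elim: s r z => [|i s IH] r z Ce zr; first by rewrite big_nil.
rewrite big_cons.
have -> : z i *: e i + \sum_(j <- s) z j *: e j =
    2^-1 *: ((2 * z i) *: e i) +
    2^-1 *: (\sum_(j <- s) (2 * z j) *: e j).
  have two0 : (2 : R) != 0 by rewrite pnatr_eq0.
  rewrite scalerA (mulKf two0) scaler_sumr; congr (_ + _).
  by apply: eq_bigr => j _; rewrite scalerA (mulKf two0).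
have r0 : 0 <= r by rewrite (le_trans _ (zr i)).
have z2 j : `|2 * z j| <= 2 * r by rewrite normrM ger0_norm// ler_pM2l.
apply: Cmid.
  apply: Ce; apply: (le_trans (z2 i)); rewrite ler_wpM2r//=.
  by rewrite exprS ler_peMr// exprn_ege1// ler1n.
apply: (IH (2 * r)) => // j a aj; apply: Ce.
by rewrite /= exprSr -mulrA.
Qed.

(** On each coordinate axis through x, convexity keeps V0 below the midpoint M of
    V0 x and c at distance at most dl; so V0 <= M on the cross-polytope spanned by
    these segments, which is a neighbourhood of x. *)
Lemma convex_open_sublevel c : open [set x | V0 x < c].
Proof.
rewrite openE => x /= Vxc.
pose D := 1 + \sum_i (`|V0 (x + e i) - V0 x| + `|V0 (x - e i) - V0 x|).
have D0 : 0 < D.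
  by rewrite /D ltr_pwDl// sumr_ge0.
have leD i : V0 (x + e i) - V0 x <= D /\ V0 (x - e i) - V0 x <= D.
  have : `|V0 (x + e i) - V0 x| + `|V0 (x - e i) - V0 x| <= D.
    by rewrite /D (bigD1 i)//= addrCA lerDl addr_ge0// sumr_ge0// => j _; rewrite addr_ge0.
  have := ler_norm (V0 (x + e i) - V0 x); have := ler_norm (V0 (x - e i) - V0 x).
  have := normr_ge0 (V0 (x + e i) - V0 x); have := normr_ge0 (V0 (x - e i) - V0 x).
  lra.
pose dl := Num.min 1 ((c - V0 x) / (2 * D)).
have dl0 : 0 < dl by rewrite lt_min ltr01/= divr_gt0 ?mulr_gt0 ?subr_gt0.
pose M := (V0 x + c) / 2.
have along i a : `|a| <= dl -> V0 (x + a *: e i) <= M.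
  rewrite le_min => /andP[a1]; rewrite ler_pdivlMr ?mulr_gt0// => aD.
  have [leD1 leD2] := leD i.
  suff : V0 (x + a *: e i) <= V0 x + `|a| * D by rewrite /M; lra.
  have a01 : 0 <= `|a| <= 1 by rewrite normr_ge0.
  have [a0|a0] := leP 0 a.
    have -> : x + a *: e i = (1 - `|a|) *: x + `|a| *: (x + e i).
      by rewrite ger0_norm// scalerDr addrA -scalerDl subrK scale1r.
    apply: le_trans (convex_functionE _ _ a01) _.
    have := normr_ge0 a; nra.
  have -> : x + a *: e i = (1 - `|a|) *: x + `|a| *: (x - e i).
    by rewrite ltr0_norm// scalerDr addrA -scalerDl subrK scale1r scaleNr scalerN opprK.
  apply: le_trans (convex_functionE _ _ a01) _.
  have := normr_ge0 a; nra.
pose r := dl / 2 ^+ n.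
have r0 : 0 < r by rewrite divr_gt0// exprn_gt0.
apply/nbhs_ballP; exists r => //= y [_ xy].
suff : V0 (x + \sum_(i <- index_enum 'I_n) (y - x) ord0 i *: e i) <= M.
  have -> : \sum_(i <- index_enum 'I_n) (y - x) ord0 i *: e i = y - x.
    by rewrite [RHS]row_sum_delta.
  by rewrite subrKC => /le_lt_trans; apply; rewrite /M; lra.
apply: (@in_cross_polytope [set u | V0 (x + u) <= M] _ r) => /=.
- by rewrite addr0 /M; lra.
- move=> u v ub vb; have -> : x + (2^-1 *: u + 2^-1 *: v) =
      (1 - 2^-1) *: (x + u) + 2^-1 *: (x + v).
    rewrite (_ : 1 - 2^-1 = 2^-1 :> R); last by field.
    rewrite !scalerDr addrACA -scalerDl (_ : 2^-1 + 2^-1 = 1 :> R) ?scale1r//.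
    by field.
  have h0 : (0 : R) <= 2^-1 by rewrite invr_ge0.
  have h1 : 2^-1 <= 1 :> R by rewrite invf_le1 ?ler1n.
  have half : 1 - 2^-1 = 2^-1 :> R by field.
  apply: le_trans (convex_functionE _ _ _) _; first by rewrite h0.
  by rewrite half; lra.
- move=> i a; rewrite /r /index_enum -enumT size_enum_ord => ar; apply: along.
  by apply: le_trans ar _; rewrite mulrC divfK// expf_neq0.
- move=> i; have := xy ord0 i; rewrite /ball/= !mxE => /ltW.
  by rewrite distrC.
Qed.

Lemma convex_measurable : measurable_fun setT V0.
Proof. exact: usc_measurable_rV convex_open_sublevel. Qed.

End convex.

(** * Uniform first-order expansions on boxes *)

Section uniform.
Context {R : realType} {d : nat}.
Implicit Types (x y z u : 'rV[R]_d) (f W : 'rV[R]_d -> R).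

Definition box (r : R) : set 'rV[R]_d := [set x | forall i, `|x ord0 i| <= r].

Lemma box_compact r : compact (box r).
Proof.
rewrite (_ : box r = [set x | forall i : 'I_d, `[- r, r]%classic (x ord0 i)]).
  apply: (@rV_compact R d (fun=> `[- r, r]%classic)) => i.
  exact: segment_compact.
by apply/seteqP; split=> x /= H i; have := H i; rewrite in_itv/= ler_norml.
Qed.

Lemma box_measurable r : measurable (box r).
Proof.
rewrite (_ : box r = [set x | forall i : 'I_d, `[- r, r]%classic (x ord0 i)]).
  by apply: (@measurable_box R d (fun=> `[- r, r]%classic)) => i; exact: measurable_itv.
by apply/seteqP; split=> x /= H i; have := H i; rewrite in_itv/= ler_norml.
Qed.

(** Each point of the box has a neighbourhood on which f varies little, and
    compactness makes the size of these neighbourhoods uniform.  Leaving x free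
    matters for [uniform_taylor1], where it need not be in the box. *)
Lemma uniform_continuity_box f r (e : R) : continuous f -> 0 < e ->
  exists2 dl, 0 < dl & forall z x, box r z ->
    (forall i, `|x ord0 i - z ord0 i| < dl) -> `|f x - f z| < e.
Proof.
move=> cf e0.
pose P (dl : R) z := forall x, (forall i, `|x ord0 i - z ord0 i| < dl) -> `|f x - f z| < e.
have : \forall dl \near 0^'+, forall z, box r z -> P dl z.
  have /compact_near_coveringP  := @box_compact r; apply=> z0 _.
  have e20 : 0 < e / 2 by rewrite divr_gt0.
  have /nbhs_ballP[rho /= rho0 H] : nbhs z0 (f @^-1` ball (f z0) (e / 2)).
    exact: (cf z0 _ (nbhsx_ballx _ _ e20)).
  have r20 : 0 < rho / 2 by rewrite divr_gt0.
  exists (ball z0 (rho / 2), [set dl : R | 0 < dl < rho / 2]) => /=.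
    split; first exact: nbhsx_ballx.
    exists (rho / 2) => //= dl; rewrite /ball/= ?sub0r ?normrN => dlr dl0.
    by rewrite dl0/= -(gtr0_norm dl0).
  move=> [z dl] /= [[_ zb] /andP[dl0 dlr]] x xz.
  have Hz : ball (f z0) (e / 2) (f z).
    apply: H; split=> // i j; apply: le_ball (zb i j).
    by rewrite ler_pdivrMr// ler_peMr ?ler1n// ltW.
  have Hx : ball (f z0) (e / 2) (f x).
    apply: H; split=> // i j; rewrite ord1.
    have := zb ord0 j; have := xz j; rewrite /ball/= !ltr_norml ![_ - _ < _]ltrBlDr.
    move=> /andP[? ?] /andP[? ?]; apply/andP; split; lra.
  move: Hz Hx; rewrite /ball/= !ltr_norml => /andP[? ?] /andP[? ?].
  by apply/andP; split; lra.
move=> [dl /= dl0 H]; exists (dl / 2); first by rewrite divr_gt0.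
move=> z x bz xz; apply: (H (dl / 2)) => //=; last by rewrite divr_gt0.
by rewrite sub0r normrN gtr0_norm ?divr_gt0// gtr_pMr// invf_lt1// ltr1n.
Qed.

Lemma derive_dotprod f x u : differentiable f x ->
  'D_u f x = dotprod (grad f x) u.
Proof.
move=> df; rewrite deriveE// [in LHS](row_sum_delta u) linear_sum.
by apply: eq_bigr => i _; rewrite linearZ/= mxE /partial deriveE// mulrC.
Qed.

Lemma is_derive_line f z u (s : R) : differentiable f (z + s *: u) ->
  is_derive s 1 (fun s => f (z + s *: u)) (dotprod (grad f (z + s *: u)) u).
Proof.
move=> df; rewrite -derive_dotprod//.
have E : (fun h : R =>
      h^-1 *: (((fun s => f (z + s *: u)) \o shift s) (h *: 1) - f (z + s *: u))) =
         (fun h : R => h^-1 *: ((f \o shift (z + s *: u)) (h *: u) - f (z + s *: u))).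
  apply/funext => h /=; congr (_ *: (f _ - _)).
  by rewrite [h *: 1]mulr1 scalerDl addrCA.
have dfu : derivable f (z + s *: u) u by exact: diff_derivable.
by split; rewrite /derivable /derive E.
Qed.

Lemma mean_value_line f z u (t : R) : (forall x, differentiable f x) -> 0 < t ->
  exists2 c, 0 < c < t & f (z + t *: u) - f z = t * dotprod (grad f (z + c *: u)) u.
Proof.
move=> df t0.
have [||c c0t] := @MVT R (fun s => f (z + s *: u))
  (fun s => dotprod (grad f (z + s *: u)) u) 0 t t0.
- by move=> x _; exact: is_derive_line.
- apply: continuous_subspaceT => s; apply: differentiable_continuous.
  by apply/derivable1_diffP; have [] := is_derive_line (df (z + s *: u)).
rewrite scale0r addr0 subr0 mulrC => ->; exists c => //.
Qed.

Lemma bounded_on_box f r : continuous f ->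
  exists2 M, 0 < M & forall x, box r x -> `|f x| <= M.
Proof.
move=> cf; have [M [_ HM]] : bounded_set (f @` box r).
  apply: compact_bounded; apply: continuous_compact; last exact: box_compact.
  exact: continuous_subspaceT.
exists (`|M| + 1); first by rewrite ltr_wpDl.
move=> x bx; apply: HM; last by exists x.
by rewrite (le_lt_trans (ler_norm M))// ltrDl.
Qed.

Lemma dotprodBl x y u : dotprod (x - y) u = dotprod x u - dotprod y u.
Proof.
rewrite /dotprod -sumrB; apply: eq_bigr => i _; rewrite !mxE; ring.
Qed.

(** The mean value theorem on the segment from z to z + t u, combined with the
    uniform continuity of the partial derivatives; 2 r bounds the coordinates of
    differences of points of the box. *)
Lemma uniform_taylor1 f (r w : R) : continuously_differentiable 1 f -> 0 < w ->
  exists2 t0, 0 < t0 & forall t z u, 0 < t < t0 -> box r z -> box (2 * r) u ->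
    `|f (z + t *: u) - f z - t * dotprod (grad f z) u| <= t * w.
Proof.
move=> [df cf] w0.
have [r0|r0] := leP r 0.
  exists 1 => // t z u /andP[t0 _] _ bu; have -> : u = 0.
    apply/rowP => i; rewrite mxE; apply/eqP; rewrite -normr_le0.
    by apply: le_trans (bu i) _; lra.
  rewrite scaler0 addr0 subrr sub0r normrN.
  have -> : dotprod (grad f z) 0 = 0.
    by apply: big1 => i _; rewrite [X in _ * X]mxE mulr0.
  by rewrite mulr0 normr0 mulr_ge0 ?ltW.
pose e := w / (d%:R * (2 * r) + 1).
have D0 : 0 < d%:R * (2 * r) + 1.
  by rewrite ltr_wpDl// mulr_ge0 ?ler0n// mulr_ge0// ltW.
have e0 : 0 < e by rewrite divr_gt0.
have [dl dl0 Hdl] : exists2 dl, 0 < dl & forall i z x, box r z ->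
    (forall i, `|x ord0 i - z ord0 i| < dl) -> `|partial i f x - partial i f z| < e.
  have /choice[g gP] : forall i, exists dl, 0 < dl /\ forall z x, box r z ->
    (forall i, `|x ord0 i - z ord0 i| < dl) -> `|partial i f x - partial i f z| < e.
    by move=> i; have [dl dl0 H] := uniform_continuity_box r (cf i) e0; exists dl.
  exists (\big[Num.min/1]_(i < d) g i).
    by apply: lt_bigmin => // i _; have [] := gP i.
  move=> i z x bz xz; apply: (gP i).2 => // j; apply: lt_le_trans (xz j) _.
  exact: bigmin_le_cond.
exists (dl / (2 * r)) => [|t z u /andP[t0 tlt] bz bu].
  by rewrite divr_gt0// mulr_gt0.
have [c /andP[c0 ct] ->] := mean_value_line z u df t0.
rewrite -mulrBr -dotprodBl normrM gtr0_norm// ler_pM2l//.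
apply: (@le_trans _ _ (\sum_(i < d) e * (2 * r))); last first.
  rewrite sumr_const card_ord -[_ *+ d]mulr_natl.
  have -> : d%:R * (e * (2 * r)) = w * ((d%:R * (2 * r)) / (d%:R * (2 * r) + 1)).
    by rewrite /e; field; rewrite gt_eqF.
  by rewrite ler_piMr ?(ltW w0)// ler_pdivrMr// mul1r lerDl.
apply: le_trans (ler_norm_sum _ _ _) _; apply: ler_sum => i _.
rewrite normrM !mxE ler_pM//; apply: ltW; apply: Hdl => // j.
rewrite !mxE addrAC subrr add0r normrM gtr0_norm//.
apply: (@le_lt_trans _ _ (c * (2 * r))).
  by rewrite ler_pM2l.
by rewrite -ltr_pdivlMr ?mulr_gt0// (lt_trans ct).
Qed.

End uniform.

Section dotprod.
Context {R : realType} {d : nat}.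
Implicit Types (x y z : 'rV[R]_d).

Lemma dotprodC x y : dotprod x y = dotprod y x.
Proof. by apply: eq_bigr => i _; rewrite mulrC. Qed.

Lemma dotprodBr x y z : dotprod x (y - z) = dotprod x y - dotprod x z.
Proof. by rewrite ![dotprod x _]dotprodC dotprodBl. Qed.

Lemma dotprodZr x y (a : R) : dotprod x (a *: y) = a * dotprod x y.
Proof. by rewrite /dotprod mulr_sumr; apply: eq_bigr => i _; rewrite !mxE mulrCA. Qed.

Lemma dotprod_box x y (r : R) : box r y -> `|dotprod x y| <= r * \sum_i `|x ord0 i|.
Proof.
move=> by_; apply: le_trans (ler_norm_sum _ _ _) _; rewrite mulr_sumr.
by apply: ler_sum => i _; rewrite normrM mulrC ler_wpM2r.
Qed.

End dotprod.

Section gradB.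
Context {R : realType} {d : nat}.
Implicit Types (f g : 'rV[R]_d -> R).

Lemma continuously_differentiable1B f g :
  continuously_differentiable 1 f -> continuously_differentiable 1 g ->
  continuously_differentiable 1 (f \- g) /\ forall x, grad (f \- g) x = grad f x - grad g x.
Proof.
move=> [df cf] [dg cg].
have pE i : partial i (f \- g) = partial i f \- partial i g.
  by apply/funext => x; rewrite /partial deriveB//; exact: diff_derivable.
split; first split.
- by move=> x; exact: differentiableB.
- by move=> i; rewrite pE => x; apply: continuousB; [exact: cf|exact: cg].
- by move=> x; apply/rowP => i; rewrite !mxE pE.
Qed.

End gradB.

Lemma expR_le_quadratic {R : realType} (x : R) : x <= 2^-1 ->
  expR x <= 1 + x + 2 * x ^+ 2.
Proof.
move=> x2; have h : 1 - x <= expR (- x) := expR_ge1Dx (- x).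
have x1 : 0 < 1 - x by lra.
rewrite -[x in expR x]opprK expRN; apply: (@le_trans _ _ (1 - x)^-1).
  by rewrite lef_pV2// posrE expR_gt0.
rewrite -[leLHS]mul1r ler_pdivrMr//; nra.
Qed.

(** * The exponent along the interpolation *)

Section pointwise.
Context {R : realType} {d : nat}.
Variables (V V0 V1 p : 'rV[R]_d -> R).
Hypothesis hV : forall x, V x = V0 x + V1 x.
Hypothesis hV0 : convex_function [set: convex_lmodType 'rV[R]_d] V0.
Hypothesis hV1 : continuously_differentiable 1 V1.
Variables (E : set 'rV[R]_d) (R0 N r : R).
Hypotheses (EB : E `<=` box R0) (R0r : R0 <= r) (pN : forall y, E y -> p y <= N).
Variable g : 'rV[R]_d -> R.
Hypothesis hg : continuously_differentiable 1 g.

Definition legendre_gap x : \bar R :=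
  ((V1 x - dotprod x (grad V1 x))%:E + legendre (V1 \+ p)%R (grad V1 x))%E.

(** An upper bound of <grad g x, x - y> over the y in [box R0]. *)
Definition drift x : R := dotprod (grad g x) x + R0 * \sum_i `|partial i g x|.

Lemma legendre_gap_ge (z y : 'rV[R]_d) : ((V1 z - dotprod z (grad V1 z)
    + (dotprod (grad V1 z) y - V1 y - p y))%:E <= legendre_gap z)%E.
Proof.
rewrite EFinD /legendre_gap leeD2l//; apply: ereal_sup_ubound.
by exists y => //=; rewrite opprD addrA.
Qed.

Lemma box_conv (t : R) (x y : 'rV[R]_d) : 0 < t < 1 -> box r x -> box r y ->
  box r ((1 - t) *: x + t *: y).
Proof.
move=> /andP[t0 t1] bx by_ i; rewrite !mxE.
apply: le_trans (ler_normD _ _) _; rewrite !normrM (gtr0_norm t0) gtr0_norm ?subr_gt0//.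
by have := bx i; have := by_ i; nra.
Qed.

(** V0 is handled by convexity alone.  The rest is a first-order expansion at z of
    W = g - V1, since (1 - t) (g - V1) x = W x - t W x; the difference between
    <grad W z, x - y> and <grad W z, z - y> is of order t, and [legendre_gap_ge]
    bounds the terms that involve both y and grad V1 z. *)
Lemma interpolation_exponent (w : R) : 0 < w ->
  exists2 t0, 0 < t0 & forall t (x y : 'rV[R]_d), 0 < t < t0 -> t < 1 -> box r x -> E y ->
    let z := (1 - t) *: x + t *: y in
    forall c, legendre_gap z = c%:E ->
    (1 - t) * (g x - V x) + t * (- V y) <=
      - V z + t * (w + N) + (g z + t * (drift z - g z + c)).
Proof.
move=> w0; pose W := g \- V1.
have [hW gradW] := continuously_differentiable1B hg hV1.
have w40 : 0 < w / 4 by rewrite divr_gt0.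
have [t1 t10 taylor] := uniform_taylor1 r hW w40.
have cW : continuous W by move=> x; apply: differentiable_continuous; have [] := hW.
have [dl dl0 unif] := uniform_continuity_box r cW w40.
exists (Num.min t1 (dl / (2 * `|r| + 1))).
  by rewrite lt_min t10 divr_gt0// ltr_wpDl// mulr_ge0.
move=> t x y /andP[t0]; rewrite lt_min => /andP[tt1 tdl] t11 bx Ey z c gapE.
have bR0 : box R0 y := EB Ey.
have by_ : box r y by move=> i; exact: le_trans (bR0 i) R0r.
have t01 : 0 < t < 1 by rewrite t0.
have bz : box r z by exact: box_conv.
pose u := x - y.
have xE : x = z + t *: u.
  by apply/rowP => i; rewrite !mxE; ring.
have zy : z - y = (1 - t) *: u.
  by apply/rowP => i; rewrite !mxE; ring.
have convV0 : V0 z <= (1 - t) * V0 x + t * V0 y.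
  by apply: convex_functionE => //; rewrite (ltW t0) ltW.
clearbody z.
have bu : box (2 * r) u.
  move=> i; rewrite !mxE; apply: le_trans (ler_normB _ _) _.
  by have := bx i; have := by_ i; lra.
have bui i := bu i.
clearbody u.
have := taylor t z u _ bz bu; rewrite t0 -xE => /(_ tt1) tay.
have Wxz : `|W x - W z| < w / 4.
  apply: unif => // i; rewrite xE !mxE addrAC subrr add0r normrM gtr0_norm//.
  apply: (@le_lt_trans _ _ (t * (2 * `|r| + 1))).
    rewrite ler_pM2l//; apply: le_trans (bui i) _.
    by have := ler_norm r; lra.
  by rewrite -ltr_pdivlMr// ltr_wpDl// mulr_ge0.
have Wzy : dotprod (grad W z) (z - y) = (1 - t) * dotprod (grad W z) u.
  by rewrite zy dotprodZr.
have := legendre_gap_ge z y; rewrite gapE lee_fin => gap.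
have drift_ge : dotprod (grad g z) (z - y) <= drift z.
  rewrite dotprodBr /drift lerD2l.
  apply: le_trans (ler_norm _) _; rewrite normrN.
  have := dotprod_box (grad g z) bR0.
  by under eq_bigr do rewrite mxE.
have pyN := pN Ey.
have WE q : W q = g q - V1 q by [].
move: Wzy; rewrite gradW !dotprodBl !dotprodBr => Wzy.
rewrite dotprodBr in drift_ge.
move: tay; rewrite gradW dotprodBl -/W.
set A := dotprod (grad g z) u in Wzy *; set B := dotprod (grad V1 z) u in Wzy *.
rewrite (dotprodC z) in gap.
move=> /[!ler_norml] /andP[tay1 tay2]; move: Wxz => /[!ltr_norml] /andP[W1 W2].
rewrite !hV.
set S := A - B in Wzy tay1 tay2 *.
have tw : t * (w / 4) <= w / 4 by rewrite ger_pMl// ltW.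
have S1 : t * S <= w / 2 by lra.
set Wx := W x in WE tay1 tay2 W1 W2 S1 *; set Wz := W z in tay1 tay2 W1 W2 S1 *.
have gxE : g x = Wx + V1 x by rewrite /Wx WE subrK.
have gzE : g z = Wz + V1 z by rewrite /Wz WE subrK.
have tWx : t * Wx >= t * (Wz - w / 4) by rewrite ler_pM2l//; lra.
have step : (1 - t) * Wx <= Wz + t * ((1 - t) * S + w - Wz).
  have : t * (t * S) <= t * (w / 2) by rewrite ler_pM2l.
  lra.
have rest : t * ((1 - t) * S + w - Wz - V1 y) <= t * (w + N + drift z - g z + c).
  by rewrite ler_pM2l//; lra.
rewrite gxE; lra.
Qed.

End pointwise.

(** * The entropy inequality on a box *)

Lemma geo_mean_le_closed {R : realType} (t a b : R) (C : \bar R) :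
  geo_mean_le t (expR a)%:E (expR b)%:E C ->
  ((expR ((1 - t) * a + t * b))%:E <= C)%E.
Proof.
case: C => [c| |] H; [|by rewrite leey|]; last first.
  have := H (a - 1) (b - 1); rewrite !lte_fin !ltr_expR !ltrBlDr !ltrDl ltr01.
  by move=> /(_ isT isT); rewrite leeNy_eq.
have He e : 0 < e -> expR ((1 - t) * a + t * b - e) <= c.
  move=> e0; have := H (a - e) (b - e); rewrite !lte_fin !ltr_expR !ltrBlDr !ltrDl e0.
  move=> /(_ isT isT); rewrite lee_fin; congr (expR _ <= _); ring.
have c0 : 0 < c by apply: lt_le_trans (He 1 ltr01); exact: expR_gt0.
rewrite lee_fin -[leRHS]lnK ?posrE// ler_expR; apply/ler_addgt0Pr => e e0.
by rewrite -lerBlDr -ler_expR lnK ?posrE// He.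
Qed.

Section interpolation.
Context {R : realType} {d : nat}.
Variables (V V0 V1 p : 'rV[R]_d -> R) (mu : probability 'rV[R]_d R).
Hypothesis hV : forall x, V x = V0 x + V1 x.
Hypothesis hV0 : convex_function [set: convex_lmodType 'rV[R]_d] V0.
Hypothesis hV1 : continuously_differentiable 1 V1.
Hypothesis hmu : forall A : set 'rV[R]_d, measurable A ->
  mu A = (\int[lebesgue_rV d]_(x in A) (expR (- V x))%:E)%E.
Variables (eps M : R).
Hypothesis eps0 : 0 < eps.
Let gap := legendre_gap V1 p.
Hypothesis mgap : measurable_fun setT (fun x => expeR ((1 + eps)%:E * gap x))%E.
Hypothesis gapM : (\int[mu]_x expeR ((1 + eps)%:E * gap x) <= M%:E)%E.
Variables (E : set 'rV[R]_d) (R0 N r : R).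
Hypotheses (mE : measurable E) (EB : E `<=` box R0) (R0r : R0 <= r).
Hypothesis (pN : forall y, E y -> p y <= N).
Variable g : 'rV[R]_d -> R.
Hypothesis hg : continuously_differentiable 1 g.

Let kappa := eps / (1 + eps).
(** The first-order term in t of the interpolation, once the fraction
    1 / (1 + eps) of the entropy term g has been spent on the Legendre gap; the
    fraction kappa = eps / (1 + eps) remains. *)
Definition tilt x : R := drift R0 g x - kappa * g x.

Lemma C1_continuous f : continuously_differentiable 1 f ->
  continuous (f : 'rV[R]_d -> R).
Proof. by move=> [df _] x; exact: differentiable_continuous. Qed.

Lemma continuous_sum_ord (F : 'I_d -> 'rV[R]_d -> R) :
  (forall i, continuous (F i)) -> continuous (fun x => \sum_i F i x).
Proof. move=> cF.
suff cs s : continuous (fun x => \sum_(i <- s) F i x) by exact: cs.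
elim: s => [|i s IH].
  have -> : (fun x => \sum_(i <- [::]) F i x) = cst 0.
    by apply/funext => y; rewrite big_nil.
  exact: cst_continuous.
have -> : (fun x => \sum_(i <- i :: s) F i x) =
    F i \+ (fun x => \sum_(i <- s) F i x).
  by apply/funext => y; rewrite big_cons.
by move=> x; exact: (cvgD (cF i x) (IH x)).
Qed.

Lemma continuous_drift : continuous (drift R0 g).
Proof.
have cg i : continuous (partial i g) := hg.2 i.
have c1 : continuous (fun x => dotprod (grad g x) x).
  apply: (@continuous_sum_ord (fun i x => grad g x ord0 i * x ord0 i)) => i y.
  have cgi : continuous (fun x => grad g x ord0 i).
    have -> : (fun x => grad g x ord0 i) = partial i g.
      by apply/funext => z; rewrite mxE.
    exact: cg.
  exact: (cvgM (cgi y) (@coord_continuous R 1 d ord0 i y)).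
have c2 : continuous (fun x => \sum_i `|partial i g x|).
  apply: (@continuous_sum_ord (fun i x => `|partial i g x|)) => i y.
  exact: (cvg_norm (cg i y)).
move=> x; apply: (cvgD (c1 x)); apply: cvgM; first exact: cvg_cst.
exact: c2.
Qed.

Lemma continuous_tilt : continuous tilt.
Proof.
have cg := C1_continuous hg.
have ckg : continuous (cst kappa \* g).
  by move=> x; exact: (cvgM (cvg_cst kappa) (cg x)).
by move=> x; exact: (cvgB (@continuous_drift x) (ckg x)).
Qed.

Let mg : measurable_fun setT g.
Proof. by apply: continuous_measurable_rV; exact: C1_continuous. Qed.

Let mtilt : measurable_fun setT tilt.
Proof. by apply: continuous_measurable_rV; exact: continuous_tilt. Qed.

Let dens z := expR (- V z).

Let mdens : measurable_fun setT dens.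
Proof.
apply: measurableT_comp => //; apply: measurableT_comp => //.
rewrite (_ : V = V0 \+ V1); last exact/funext.
apply: measurable_funD; first exact: convex_measurable.
by apply: continuous_measurable_rV; exact: C1_continuous.
Qed.

Let int_dens (f : 'rV[R]_d -> \bar R) D : measurable D -> measurable_fun setT f ->
  (forall x, (0 <= f x)%E) ->
  (\int[lebesgue_rV d]_x ((f \_ D) x * (dens x)%:E) = \int[mu]_(x in D) f x)%E.
Proof.
move=> mD mf f0; rewrite [RHS]integral_mkcond.
rewrite (@ge0_integral_density _ _ _ (lebesgue_rV d) mu dens)//.
- by move=> x; exact: expR_ge0.
- by apply/(measurable_restrictT _ _).1 => //; exact: measurable_funTS.
- by move=> x; apply: erestrict_ge0.
Qed.

(** Prekopa-Leindler for e^(g - V) on the box and e^(- V) on E.  The exponent of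
    [interpolation_exponent] is the convex combination, with weight
    la = t / (1 + eps), of (1 + eps) gap and of g + t / (1 - la) tilt, which
    splits the integral into the hypothesis on the gap and an integral of bounded
    functions. *)
Lemma interpolated_integral (w : R) : 0 < w ->
  exists2 t0, 0 < t0 & forall t, 0 < t < t0 -> t < 1 ->
  let la := t / (1 + eps) in
  geo_mean_le t (\int[mu]_(x in box r) (expR (g x))%:E) (mu E)
    ((expR (t * (w + N)))%:E * (la%:E * M%:E + (1 - la)%:E *
      \int[mu]_(x in box r) (expR (g x + t / (1 - la) * tilt x))%:E))%E.
Proof.
move=> w0; have [t0 t00 ineq] :=
  interpolation_exponent hV hV0 hV1 EB R0r pN hg w0.
exists t0 => // t t0t t1 la; have /andP[tpos _] := t0t.
have t01 : 0 < t < 1 by rewrite tpos.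
have eps1 : 0 < 1 + eps by rewrite addr_gt0.
have la01 : 0 < la < 1.
  rewrite /la divr_gt0//= ltr_pdivrMr// mul1r (lt_trans t1)// ltrDl//.
have /andP[la0 la1] := la01.
pose v x := g x + t / (1 - la) * tilt x.
have mv : measurable_fun setT v.
  by apply: measurable_funD => //; exact: measurable_funM.
pose h1 x := (la%:E * expeR ((1 + eps)%:E * gap x) + ((1 - la) * expR (v x))%:E)%E.
pose h x := ((expR (t * (w + N)))%:E * h1 x)%E.
have mev : measurable_fun setT (fun x => (expR (v x))%:E).
  by apply/measurable_EFinP; exact: measurableT_comp.
have mev2 : measurable_fun setT (fun x => ((1 - la) * expR (v x))%:E).
  by apply/measurable_EFinP; apply: measurable_funM => //; exact: measurableT_comp.
have mh1 : measurable_fun setT h1.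
  by apply: emeasurable_funD => //; exact: emeasurable_funM.
have mh : measurable_fun setT h by exact: emeasurable_funM.
have ev0 x : (0 <= ((1 - la) * expR (v x))%:E)%E.
  by rewrite lee_fin mulr_ge0 ?expR_ge0// subr_ge0 ltW.
have h10 x : (0 <= h1 x)%E.
  by rewrite adde_ge0// mule_ge0 ?expeR_ge0// lee_fin ltW.
have h0 x : (0 <= h x)%E by rewrite mule_ge0// lee_fin expR_ge0.
have mbox : measurable (@box R d r) by exact: box_measurable.
pose F z := (((fun z => (expR (g z))%:E) \_ (box r)) z * (dens z)%:E)%E.
pose G z := (((cst 1%E) \_ E) z * (dens z)%:E)%E.
pose H z := ((h \_ (box r)) z * (dens z)%:E)%E.
have meg : measurable_fun setT (fun z => (expR (g z))%:E).
  by apply/measurable_EFinP; exact: measurableT_comp.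
have mF (f : 'rV[R]_d -> \bar R) D : measurable D -> measurable_fun setT f ->
    measurable_fun setT (fun z => ((f \_ D) z * (dens z)%:E)%E).
  move=> mD mf; apply: emeasurable_funM; last exact/measurable_EFinP.
  by apply/(measurable_restrictT _ _).1 => //; exact: measurable_funTS.
have F0 (f : 'rV[R]_d -> \bar R) D z : (forall x, (0 <= f x)%E) ->
    (0 <= (f \_ D) z * (dens z)%:E)%E.
  by move=> f0; rewrite mule_ge0 ?lee_fin ?expR_ge0//; exact: erestrict_ge0.
have := @prekopa_leindler R t d F G H t01.
rewrite /F /G /H !int_dens//.
rewrite integral_cst// mul1e => PL.
apply: geo_mean_leS (PL _ _ _ _ _ _ _) => //; try (exact: mF).
- have mT (f : 'rV[R]_d -> \bar R) : measurable_fun setT f -> measurable_fun (box r) f.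
    exact: measurable_funTS.
  have e0 : (0 <= (expR (t * (w + N)))%:E)%E by rewrite lee_fin expR_ge0.
  have lae0 : (0 <= la%:E)%E by rewrite lee_fin ltW.
  have lae1 : (0 <= (1 - la)%:E)%E by rewrite lee_fin subr_ge0 ltW.
  have mlg : measurable_fun setT (fun x => la%:E * expeR ((1 + eps)%:E * gap x))%E.
    exact: emeasurable_funM.
  rewrite ge0_integralZl ?lee_wpmul2l//; try exact: mT.
  rewrite ge0_integralD//; try exact: mT; last first.
    by move=> x _; rewrite mule_ge0 ?expeR_ge0.
  apply: leeD.
    rewrite ge0_integralZl//; try exact: mT; last first.
      by move=> x _; exact: expeR_ge0.
    rewrite lee_wpmul2l//; apply: le_trans gapM.
    by apply: ge0_subset_integral => // x _; exact: expeR_ge0.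
  rewrite -ge0_integralZl//; try exact: mT.
- by move=> x; apply: F0 => y; rewrite lee_fin expR_ge0.
- by move=> x; apply: F0 => y; rewrite lee_fin.
- by move=> x; exact: F0.
move=> x y a b; rewrite !patchE.
case: ifPn => [/set_mem bx|_]; last by rewrite mul0e lte_fin ltNge expR_ge0.
case: ifPn => [/set_mem Ey|_]; last first.
  by move=> _; rewrite mul0e lte_fin ltNge expR_ge0.
rewrite -EFinM mul1e !lte_fin /dens -expRD !ltr_expR => ag by_.
have by' : box r y by move=> i; exact: le_trans (EB Ey i) R0r.
set z := (1 - t) *: x + t *: y.
have bz : box r z by exact: box_conv.
rewrite mem_set//.
case gapE : (gap z) => [c| |].
- have Hle := ineq t x y t0t t1 bx Ey c gapE.
  have -> : (h z * (expR (- V z))%:E)%E = (expR (t * (w + N)) *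
      (la * expR ((1 + eps) * c) + (1 - la) * expR (v z)) * expR (- V z))%:E.
    by rewrite /h /h1 gapE 2!EFinM EFinD EFinM.
  rewrite lee_fin.
  have conv : expR (la * ((1 + eps) * c) + (1 - la) * v z) <=
      la * expR ((1 + eps) * c) + (1 - la) * expR (v z).
    have := @expR_convex R (1 - la) ((1 + eps) * c) (v z).
    rewrite opprB addrCA subrr addr0; apply.
    by rewrite subr_ge0 (ltW la1) lerBlDr lerDl ltW.
  apply: (@le_trans _ _ (expR (t * (w + N)) *
    expR (la * ((1 + eps) * c) + (1 - la) * v z) * expR (- V z))); last first.
    by rewrite ler_wpM2r ?expR_ge0// ler_wpM2l ?expR_ge0.
  rewrite -!expRD ler_expR.
  have -> : la * ((1 + eps) * c) + (1 - la) * v z = g z + t * (drift R0 g z - g z + c).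
    rewrite /v /tilt /kappa /la; field.
    by rewrite gt_eqF//= gt_eqF// subr_gt0 (lt_trans t1)// ltrDl.
  apply: (@le_trans _ _ ((1 - t) * (g x - V x) + t * (- V y))).
    by apply: lerD; rewrite ler_pM2l ?subr_gt0// ltW.
  by rewrite -/z in Hle; lra.
- rewrite /h /h1 gapE mulry gtr0_sg ?addr_gt0// mul1e/= gt0_muley ?lte_fin//.
  by rewrite addye// gt0_muley ?lte_fin ?expR_gt0// gt0_mulye ?lte_fin ?expR_gt0// leey.
- by have := legendre_gap_ge V1 p z y; rewrite -/gap gapE leeNy_eq.
Qed.

Lemma integrable_box (f : 'rV[R]_d -> R) : continuous f ->
  mu.-integrable (box r) (EFin \o f).
Proof.
move=> cf; apply: measurable_bounded_integrable.
- exact: box_measurable.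
- by apply: le_lt_trans (probability_le1 _ _) _; [exact: box_measurable|exact: ltry].
- by apply: measurable_funTS; exact: continuous_measurable_rV.
have [B B0 fB] := bounded_on_box r cf.
exists B; split; first exact: num_real.
by move=> y By x bx; exact: le_trans (fB x bx) (ltW By).
Qed.

(** The first-order part as t -> 0 of [interpolated_integral].  As tilt is bounded
    on the box, an expansion of the exponential to second order suffices. *)
Lemma core_inequality : (\int[mu]_(x in box r) (expR (g x))%:E = 1)%E ->
  (0 < mu E)%E ->
  ((ln (fine (mu E)))%:E <= ((M - 1) / (1 + eps) + N)%:E +
    \int[mu]_(x in box r) (expR (g x) * tilt x)%:E)%E.
Proof.
move=> g1 muE0.
have mbox : measurable (@box R d r) by exact: box_measurable.
have cexpg : continuous (expR \o g).
  by move=> x; apply: continuous_comp; [exact: C1_continuous|exact: continuous_expR].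
have ieg : mu.-integrable (box r) (fun x => (expR (g x))%:E) := integrable_box cexpg.
have ctl := continuous_tilt.
have cegY : continuous (fun x => expR (g x) * tilt x).
  by move=> x; exact: (cvgM (cexpg x) (ctl x)).
have iegY : mu.-integrable (box r) (fun x => (expR (g x) * tilt x)%:E) := integrable_box cegY.
have JE := integrable_fin_num mbox iegY.
rewrite -(fineK JE); set J := fine (\int[mu]_(x in box r) _).
have AE : mu E \is a fin_num by exact: fin_num_measure.
set A := fine (mu E).
have A0 : 0 < A by rewrite fine_gt0// muE0/= ltey_eq AE.
rewrite -EFinD lee_fin; apply/ler_addgt0Pr => w0 w00.
pose w := w0 / 2.
have w1 : 0 < w by rewrite divr_gt0.
have [B B0 tB] := bounded_on_box r ctl.
have [t0 t00 interp] := interpolated_integral w1.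
(* t is small enough for the interpolation, for t / (1 - la) <= 2 t, for the
   quadratic bound on the exponential, and for its remainder to be at most w *)
pose t := Num.min (Num.min (t0 / 2) 2^-1) (Num.min (4 * B)^-1 (w / (4 * B ^+ 2))).
have B4 : 0 < 4 * B by rewrite mulr_gt0.
have B42 : 0 < 4 * B ^+ 2 by rewrite mulr_gt0// exprn_gt0.
have tpos : 0 < t.
  by rewrite !lt_min (divr_gt0 t00)// (divr_gt0 w1 B42) !invr_gt0 B4 ltr0n.
have [tt0 t2 tB1 tB2] : [/\ t <= t0 / 2, t <= 2^-1, t <= (4 * B)^-1 & t <= w / (4 * B ^+ 2)].
  by split; rewrite !ge_min lexx ?orbT.
have tlt0 : 0 < t < t0 by rewrite tpos/=; lra.
have t1 : t < 1 by lra.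
have := interp t tlt0 t1; set la := t / (1 + eps) => /= PL.
have lat : 0 < la <= t.
  by rewrite divr_gt0 ?addr_gt0//= ler_pdivrMr ?addr_gt0// ler_peMr ?(ltW tpos)// lerDl ltW.
have laE : la = t * (1 + eps)^-1 by [].
clearbody la.
have la1 : 2^-1 <= 1 - la by lra.
set tau := t / (1 - la) in PL *.
have la10 : 0 < 1 - la by lra.
have tau0 : 0 < tau by rewrite divr_gt0.
have tau2 : tau <= 2 * t by rewrite ler_pdivrMr//; nra.
have tauB : tau * B <= 2^-1.
  apply: (@le_trans _ _ (2 * t * B)); first by rewrite ler_pM2r.
  move: tB1; rewrite -[X in _ <= X]mul1r ler_pdivlMr// => h; lra.
have tauB2 : 2 * tau * B ^+ 2 <= w.
  move: tB2; rewrite ler_pdivlMr// => h.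
  have : tau * B ^+ 2 <= 2 * t * B ^+ 2 by rewrite ler_pM2r// exprn_gt0.
  lra.
have I_le : (\int[mu]_(x in box r) (expR (g x + tau * tilt x))%:E <=
    (1 + 2 * tau ^+ 2 * B ^+ 2 + tau * J)%:E)%E.
  apply: (@le_trans _ _ (\int[mu]_(x in box r)
      ((1 + 2 * tau ^+ 2 * B ^+ 2)%:E * (expR (g x))%:E + tau%:E * (expR (g x) * tilt x)%:E)))%E.
    apply: ge0_le_integral => //.
    - apply: measurable_funTS; apply/measurable_EFinP; apply: measurableT_comp => //.
      by apply: measurable_funD => //; exact: measurable_funM.
    - apply: measurable_funTS; apply: emeasurable_funD; apply: emeasurable_funM => //.
      + by apply/measurable_EFinP; exact: measurableT_comp.
      + by apply/measurable_EFinP; apply: measurable_funM => //; exact: measurableT_comp.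
    move=> x bx; rewrite -!EFinM -EFinD lee_fin expRD.
    have -> : (1 + 2 * tau ^+ 2 * B ^+ 2) * expR (g x) + tau * (expR (g x) * tilt x) =
      expR (g x) * (1 + tau * tilt x + 2 * (tau * B) ^+ 2) by ring.
    rewrite ler_pM2l ?expR_gt0//.
    have := tB x bx; rewrite ler_norml => /andP[tB3 tB4].
    have h : tau * tilt x <= tau * B by rewrite ler_pM2l.
    have h' : - (tau * B) <= tau * tilt x by rewrite -mulrN ler_pM2l.
    apply: le_trans (expR_le_quadratic _) _; first exact: le_trans tauB.
    rewrite lerD2l ler_pM2l// -[leLHS]real_normK ?num_real//.
    have tB0 : 0 <= tau * B := mulr_ge0 (ltW tau0) (ltW B0).
    rewrite ler_sqr ?nnegrE//.
    by rewrite ler_norml h h'.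
  have i1 := integrableZl mbox (1 + 2 * tau ^+ 2 * B ^+ 2) ieg.
  have i2 := integrableZl mbox tau iegY.
  have -> : (\int[mu]_(x in box r) ((1 + 2 * tau ^+ 2 * B ^+ 2)%:E * (expR (g x))%:E +
        tau%:E * (expR (g x) * tilt x)%:E) =
      \int[mu]_(x in box r) ((1 + 2 * tau ^+ 2 * B ^+ 2)%:E * (expR (g x))%:E) +
      \int[mu]_(x in box r) (tau%:E * (expR (g x) * tilt x)%:E))%E.
    exact (integralD mbox i1 i2).
  by rewrite !integralZl// g1 mule1 -(fineK JE) -/J -EFinM -EFinD.
have key : expR (t * ln A) <= expR (t * (w + N)) *
    (la * M + (1 - la) * (1 + 2 * tau ^+ 2 * B ^+ 2 + tau * J)).
  rewrite -lee_fin [leRHS]EFinM EFinD 2!EFinM.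
  have PL0 : geo_mean_le t (expR 0)%:E (expR (ln A))%:E
    ((expR (t * (w + N)))%:E * (la%:E * M%:E + (1 - la)%:E *
      \int[mu]_(x in box r) (expR (g x + tau * tilt x))%:E))%E.
    by rewrite lnK ?posrE// expR0 (fineK AE) -g1.
  have := geo_mean_le_closed PL0; rewrite mulr0 add0r => /le_trans; apply.
  rewrite lee_wpmul2l ?lee_fin ?expR_ge0// leeD2l// lee_wpmul2l// lee_fin.
  exact: ltW.
have {}key : expR (t * (ln A - w - N)) <=
    la * M + (1 - la) * (1 + 2 * tau ^+ 2 * B ^+ 2 + tau * J).
  rewrite -(@ler_pM2l _ (expR (t * (w + N)))) ?expR_gt0// -expRD.
  by apply: le_trans key; rewrite ler_expR; lra.
have := expR_ge1Dx (t * (ln A - w - N)).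
have latau : (1 - la) * tau = t by rewrite /tau mulrC divfK// gt_eqF.
have E1 : (1 - la) * (1 + 2 * tau ^+ 2 * B ^+ 2 + tau * J) =
    1 - la + t * (2 * tau * B ^+ 2) + t * J by rewrite -latau; ring.
rewrite E1 laE in key => tangent.
have {}key : t * (ln A - w - N) <=
    t * ((M - 1) / (1 + eps) + 2 * tau * B ^+ 2 + J) by lra.
by move: key tauB2; rewrite ler_pM2l// /w => key tauB2; lra.
Qed.

End interpolation.

(** * The Young inequality with a logarithmic weight *)

Section young.
Context {R : realType}.

Lemma powRD_le (a b alpha : R) : 0 <= a -> 0 <= b -> 0 < alpha <= 2 ->
  (a + b) `^ alpha <= 4 * (a `^ alpha + b `^ alpha).
Proof.
move=> a0 b0 /andP[al0 al2]; pose M := Num.max a b.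
have M0 : 0 <= M by rewrite le_max a0.
have abM : a + b <= 2 * M.
  have : a <= M by rewrite le_max lexx.
  have : b <= M by rewrite le_max lexx orbT.
  lra.
apply: (@le_trans _ _ ((2 * M) `^ alpha)).
  by rewrite ge0_ler_powR ?nnegrE ?(ltW al0)// ?addr_ge0// mulr_ge0.
rewrite powRM//; apply: ler_pM; rewrite ?powR_ge0//.
  apply: (@le_trans _ _ (2 `^ 2)); first by rewrite ler_powR// ler1n.
  by rewrite (powR_mulrn 2)//; lra.
rewrite /M; have [ab|ab] := leP a b.
  by rewrite lerDr powR_ge0.
by rewrite lerDl powR_ge0.
Qed.

Lemma le_powR_add1 (y alpha : R) : 0 <= y -> 1 <= alpha -> y <= 1 + y `^ alpha.
Proof.
move=> y0 al1; have [y1|y1] := leP y 1.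
  by rewrite (le_trans y1)// lerDl powR_ge0.
apply: (@le_trans _ _ (y `^ alpha)); last by rewrite lerDr.
by rewrite -[leLHS]powRr1// ler_powR// ltW.
Qed.

(** With rho = a + R0, L = ln (e + s) and c = 8 / eta: if rho^alpha <= c L, then
    rho^2 L^(1 - 2/alpha) <= c^(2/alpha) L, and s L is comparable to
    (s + 1) ln (s + 1) + (s + 1).  Otherwise s <= e^(rho^alpha / c), the factor
    rho^2 costs at most another e^(rho^alpha / c), and
    2 rho^alpha / c <= eta (a^alpha + R0^alpha). *)
Lemma log_tradeoff (alpha eta R0 : R) : 1 < alpha <= 2 -> 0 < eta -> 0 <= R0 ->
  exists c2 C : R, [/\ 0 < c2, 0 < C & forall s a, 0 <= s -> 0 <= a ->
    s * (a + R0) ^+ 2 / (ln (expR 1 + s)) `^ (2 / alpha - 1) <=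
    c2 * ((s + 1) * ln (s + 1) + (s + 1)) + C * expR (eta * a `^ alpha)].
Proof.
move=> /andP[al1 al2] eta0 R00; pose c := 8 / eta.
have al0 : 0 < alpha by lra.
have c0 : 0 < c by rewrite divr_gt0.
have theta0 : 0 <= 2 / alpha - 1 by rewrite subr_ge0 ler_pdivlMr// mul1r.
exists (c `^ (2 / alpha)), ((1 + 2 * c) ^+ 2 * expR (eta * R0 `^ alpha)); split.
- exact: powR_gt0.
- by rewrite mulr_gt0 ?expR_gt0// exprn_gt0// addr_gt0// mulr_gt0.
move=> s a s0 a0; set L := ln (expR 1 + s).
have es0 : 0 < expR 1 + s by rewrite ltr_pwDl// expR_gt0.
have L1 : 1 <= L by rewrite -[X in X <= _]expRK ler_ln ?posrE ?expR_gt0// lerDl.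
have L0 : 0 < L by lra.
have LthP : 0 < L `^ (2 / alpha - 1) by exact: powR_gt0.
have Lth1 : 1 <= L `^ (2 / alpha - 1).
  by rewrite -[X in X <= _](powRr0 L) ler_powR.
set rho := a + R0; have rho0 : 0 <= rho by rewrite addr_ge0.
have lns : 0 <= ln (s + 1) by rewrite ln_ge0// lerDr.
have Phi0 : 0 <= (s + 1) * ln (s + 1) + (s + 1).
  by rewrite addr_ge0 ?mulr_ge0// addr_ge0.
have [small|big] := leP (rho `^ alpha) (c * L).
- rewrite -[X in X <= _]addr0; apply: lerD; last first.
    by rewrite mulr_ge0 ?expR_ge0// mulr_ge0 ?expR_ge0// exprn_ge0// addr_ge0// mulr_ge0// ltW.
  have sL : s * L <= (s + 1) * ln (s + 1) + (s + 1).
    have : L <= ln (s + 1) + 1.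
      rewrite -[X in _ + X]expRK -lnM ?posrE ?expR_gt0// ?ltr_wpDl// ler_ln ?posrE//.
        have := @expR_gt1Dx R 1; rewrite oner_neq0 => /(_ isT) e1.
        by nra.
      by rewrite mulr_gt0 ?expR_gt0// ltr_wpDl.
    move=> LL; apply: (@le_trans _ _ ((s + 1) * L)).
      by rewrite ler_wpM2r ?(ltW L0)// lerDl.
    have -> : (s + 1) * ln (s + 1) + (s + 1) = (s + 1) * (ln (s + 1) + 1) by ring.
    by rewrite ler_wpM2l// addr_ge0.
  apply: (@le_trans _ _ (c `^ (2 / alpha) * (s * L))); last first.
    by rewrite ler_wpM2l// powR_ge0.
  have rho2 : rho ^+ 2 <= c `^ (2 / alpha) * (L `^ (2 / alpha - 1) * L).
    have -> : rho ^+ 2 = (rho `^ alpha) `^ (2 / alpha).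
      by rewrite -powRrM mulrCA divff ?gt_eqF// mulr1 -powR_mulrn.
    apply: (@le_trans _ _ ((c * L) `^ (2 / alpha))).
      rewrite ge0_ler_powR ?nnegrE ?powR_ge0//.
        by rewrite divr_ge0// ltW.
      by rewrite mulr_ge0// ltW.
    have -> : L `^ (2 / alpha - 1) * L = L `^ (2 / alpha).
      rewrite -[X in _ * X](powRr1 (ltW L0)) -powRD ?subrK//.
      by rewrite [L == 0]gt_eqF ?implybT.
    by rewrite (powRM _ (ltW c0) (ltW L0)).
  rewrite ler_pdivrMr//.
  apply: (@le_trans _ _ (s * (c `^ (2 / alpha) * (L `^ (2 / alpha - 1) * L)))).
    by rewrite ler_wpM2l.
  by rewrite le_eqVlt; apply/orP; left; apply/eqP; ring.
- rewrite -[X in X <= _]add0r; apply: lerD.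
    by rewrite mulr_ge0// powR_ge0.
  set y := rho `^ alpha in big *.
  have y0 : 0 <= y by exact: powR_ge0.
  apply: (@le_trans _ _ (s * rho ^+ 2)).
    by rewrite ler_pdivrMr// ler_peMr// mulr_ge0// exprn_ge0.
  have sy : s <= expR (y / c).
    apply: (@le_trans _ _ (expR 1 + s)); first by rewrite lerDr expR_ge0.
    by rewrite -[X in X <= _]lnK ?posrE// ler_expR ler_pdivlMr// mulrC ltW.
  have rhoy : rho ^+ 2 <= (1 + 2 * c) ^+ 2 * expR (y / c).
    have : rho <= (1 + 2 * c) * expR (y / (2 * c)).
      apply: (le_trans (le_powR_add1 rho0 (ltW al1))); rewrite -/y.
      apply: (@le_trans _ _ ((1 + 2 * c) * (1 + y / (2 * c)))).
        have -> : (1 + 2 * c) * (1 + y / (2 * c)) = 1 + y + 2 * c + y / (2 * c).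
          by field; rewrite gt_eqF.
        by rewrite -addrA lerDl addr_ge0// ?divr_ge0// mulr_ge0// ltW.
      by rewrite ler_wpM2l ?expR_ge1Dx// addr_ge0// mulr_ge0// ltW.
    move=> /(lerXn2r 2) h; apply: le_trans (h _ _) _; rewrite ?nnegrE//.
      by rewrite mulr_ge0 ?expR_ge0// addr_ge0// mulr_ge0// ltW.
    rewrite exprMn [expR _ ^+ 2]expr2 -expRD.
    have -> // : y / (2 * c) + y / (2 * c) = y / c.
    by field; rewrite gt_eqF.
  apply: (@le_trans _ _ (expR (y / c) * ((1 + 2 * c) ^+ 2 * expR (y / c)))).
    by rewrite ler_pM// exprn_ge0.
  rewrite mulrCA -[leRHS]mulrA; apply: ler_wpM2l; first exact: sqr_ge0.
  rewrite -!expRD ler_expR.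
  have := powRD_le a0 R00 _; rewrite -/rho -/y => /(_ alpha) h.
  have {}h : y <= 4 * (a `^ alpha + R0 `^ alpha) by apply: h; rewrite al0.
  have -> : y / c + y / c = (eta / 4) * y by rewrite /c; field; rewrite gt_eqF.
  have : eta / 4 * y <= eta / 4 * (4 * (a `^ alpha + R0 `^ alpha)).
    by rewrite ler_wpM2l// divr_ge0// ltW.
  lra.
Qed.

(** Here f, q, a and D stand for f x, |grad f x|, |x| and the dimension, and the
    entropy term comes with an arbitrarily small factor k. *)
Lemma young_log (alpha eta R0 k D : R) : 1 < alpha <= 2 -> 0 < eta -> 0 <= R0 ->
  0 < k -> 0 <= D ->
  exists C5 C6 : R, [/\ 0 < C5, 0 < C6 & forall m f q a, 0 < m -> 0 <= q -> 0 <= a ->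
    let s := f ^+ 2 / m in
    2 * D * (`|f| / m) * q * (a + R0) <=
    k * ((s + 1) * ln (s + 1) + (s + 1)) + C5 * expR (eta * a `^ alpha) +
    C6 * (q ^+ 2 * (ln (expR 1 + s)) `^ (2 / alpha - 1) / m)].
Proof.
move=> hal eta0 R00 k0 D0.
have [c2 [C [c20 C0 H]]] := log_tradeoff hal eta0 R00.
pose b := k / (c2 * (D ^+ 2 + 1)).
have D1 : 0 < D ^+ 2 + 1 by rewrite ltr_wpDl// sqr_ge0.
have b0 : 0 < b by rewrite divr_gt0// mulr_gt0.
exists (k / c2 * C), b^-1; split.
- by rewrite mulr_gt0// divr_gt0.
- by rewrite invr_gt0.
move=> m f q a m0 q0 a0 /=; set s := f ^+ 2 / m.
have s0 : 0 <= s by rewrite divr_ge0 ?sqr_ge0// ltW.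
have := H s a s0 a0; set P := _ `^ (2 / alpha - 1) => Hsa.
have P0 : 0 < P.
  apply: powR_gt0; rewrite ln_gt0// ltr_wpDr//.
  by have := @expR_gt1Dx R 1; rewrite oner_neq0 => /(_ isT); lra.
set rho := a + R0 in Hsa *; have rho0 : 0 <= rho by rewrite addr_ge0.
have amgm : 2 * D * (`|f| / m) * q * rho <=
    b^-1 * (q ^+ 2 * P / m) + b * D ^+ 2 * (s * rho ^+ 2 / P).
  have E : b^-1 * (q ^+ 2 * P / m) + b * D ^+ 2 * (s * rho ^+ 2 / P) -
      2 * D * (`|f| / m) * q * rho = (q * P - b * D * `|f| * rho) ^+ 2 / (b * P * m).
    rewrite /s -[f ^+ 2]real_normK ?num_real//; field.
    by rewrite !gt_eqF.
  rewrite -subr_ge0 E; apply: divr_ge0; first exact: sqr_ge0.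
  exact: ltW (mulr_gt0 (mulr_gt0 b0 P0) m0).
apply: (le_trans amgm); rewrite addrC lerD2r.
apply: (@le_trans _ _ (k / c2 * (s * rho ^+ 2 / P))).
  apply: ler_wpM2r; first exact: divr_ge0 (mulr_ge0 s0 (sqr_ge0 _)) (ltW P0).
  have -> : b * D ^+ 2 = k / c2 * (D ^+ 2 / (D ^+ 2 + 1)).
    by rewrite /b; field; rewrite !gt_eqF.
  apply: ler_piMr; first exact: divr_ge0 (ltW k0) (ltW c20).
  by rewrite ler_pdivrMr// mul1r lerDl.
apply: (@le_trans _ _ (k / c2 *
    (c2 * ((s + 1) * ln (s + 1) + (s + 1)) + C * expR (eta * a `^ alpha)))).
  by rewrite ler_wpM2l// divr_ge0 ?ltW.
by rewrite mulrDr !mulrA divfK ?gt_eqF.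
Qed.

End young.

(** * The entropy of f^2 on a box *)

Section chain_rule.
Context {R : realType} {d : nat}.

Lemma continuously_differentiable1_comp (phi phi' : R -> R) (f : 'rV[R]_d -> R) :
  (forall y, is_derive y (1 : R) phi (phi' y)) -> continuous phi' ->
  continuously_differentiable 1 f ->
  continuously_differentiable 1 (phi \o f) /\
  forall i x, partial i (phi \o f) x = phi' (f x) * partial i f x.
Proof.
move=> dphi cphi' [df cf].
have dphi2 y : differentiable phi y by apply/derivable1_diffP; exact: ex_derive.
have dcomp x : differentiable (phi \o f) x by exact: differentiable_comp.
have pE i x : partial i (phi \o f) x = phi' (f x) * partial i f x.
  rewrite /partial !deriveE// diff_comp//= deriv1E; last exact: ex_derive.
  by rewrite derive1E derive_val mulrC.
split=> //; split=> // i x.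
have -> : partial i (phi \o f) = (phi' \o f) \* partial i f.
  by apply/funext => y; rewrite pE.
apply: (cvgM _ (cf i x)); apply: (continuous_comp (differentiable_continuous (df x))).
exact: cphi'.
Qed.

Lemma is_derive_ln_sqr (m c y : R) : 0 < m ->
  is_derive y (1 : R) (fun y => ln (y ^+ 2 / m + 1) - c) (2 * y / m / (y ^+ 2 / m + 1)).
Proof.
move=> m0.
have pos : 0 < y ^+ 2 / m + 1 by rewrite ltr_wpDl// divr_ge0 ?sqr_ge0// ltW.
have d0 := is_derive_id y (1 : R).
have d1 := is_deriveD (is_deriveZ m^-1 (is_deriveM d0 d0)) (is_derive_cst (1 : R) y (1 : R)).
have E : m^-1 \*: (id * id) + cst 1 = (fun y => y ^+ 2 / m + 1) :> (R -> R).
  by apply/funext => z; rewrite -[LHS]/(m^-1 * (z * z) + 1) expr2 mulrC.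
rewrite E in d1.
have d2 := is_derive1_ln pos.
have d3 := @is_derive1_comp R (@ln R) (fun y => y ^+ 2 / m + 1) y _ _ d2 d1.
have d4 := is_deriveB d3 (is_derive_cst c y (1 : R)).
apply: (is_derive_eq d4).
rewrite !scaler1 addr0 subr0 mulrC; congr (_ * _).
by rewrite -[_ *: _]/(m^-1 * (y + y)); ring.
Qed.

End chain_rule.

(** The negative part of f can only lower its integral, even to -oo; the positive
    part is dominated by g. *)
Lemma ge0_le_integral_semi {d} {T : measurableType d} {R : realType}
    (mu : {measure set T -> \bar R}) (D : set T) (f g : T -> \bar R) :
  measurable D -> measurable_fun D f -> measurable_fun D g ->
  (forall x, D x -> 0 <= g x)%E -> (forall x, D x -> f x <= g x)%E ->
  (\int[mu]_(x in D) f x <= \int[mu]_(x in D) g x)%E.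
Proof.
move=> mD mf mg g0 fg; rewrite integralE.
apply: (@le_trans _ _ (\int[mu]_(x in D) f^\+ x)%E).
  rewrite -[leRHS]adde0 leeD2l// leeNl oppe0.
  by apply: integral_ge0 => x _; exact: funeneg_ge0.
apply: ge0_le_integral => //.
- exact: measurable_funepos.
- by move=> x Dx; rewrite funeposE ge_max fg// g0.
Qed.

Section euclidean_norm.
Context {R : realType} {d : nat}.
Implicit Types x y : 'rV[R]_d.

Lemma coord_le_enorm x i : `|x ord0 i| <= enorm x.
Proof.
rewrite -sqrtr_sqr; apply: ler_wsqrtr; rewrite /dotprod (bigD1 i)//= -expr2 lerDl.
by apply: sumr_ge0 => j _; rewrite -expr2 sqr_ge0.
Qed.

Lemma sum_coord_le_enorm x : \sum_i `|x ord0 i| <= d%:R * enorm x.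
Proof.
apply: (@le_trans _ _ (\sum_(i < d) enorm x)).
  by apply: ler_sum => i _; exact: coord_le_enorm.
by rewrite sumr_const card_ord mulr_natl.
Qed.

Lemma dotprod_le_enorm x y : `|dotprod x y| <= d%:R * enorm x * enorm y.
Proof.
apply: le_trans (ler_norm_sum _ _ _) _.
apply: (@le_trans _ _ (\sum_(i < d) enorm x * enorm y)).
  apply: ler_sum => i _; rewrite normrM.
  by apply: ler_pM => //; exact: coord_le_enorm.
by rewrite sumr_const card_ord -[_ *+ d]mulr_natl mulrA.
Qed.

Lemma enorm_ge0 x : 0 <= enorm x. Proof. exact: sqrtr_ge0. Qed.

Lemma measurable_enorm : measurable_fun setT (@enorm R d).
Proof.
apply: continuous_measurable_rV => x.
have c1 : continuous (fun x : 'rV[R]_d => dotprod x x).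
  apply: (@continuous_sum_ord _ _ (fun i (x : 'rV[R]_d) => x ord0 i * x ord0 i)) => i y.
  by have ci := @coord_continuous R 1 d ord0 i y; exact: (cvgM ci ci).
exact: (continuous_comp (c1 x) (@sqrt_continuous R _)).
Qed.

Lemma measurable_enorm_grad (f : 'rV[R]_d -> R) : continuously_differentiable 1 f ->
  measurable_fun setT (fun x => enorm (grad f x)).
Proof.
move=> [_ cf]; apply: continuous_measurable_rV => x.
have c1 : continuous (fun x => dotprod (grad f x) (grad f x)).
  have -> : (fun x => dotprod (grad f x) (grad f x)) =
      (fun x => \sum_i partial i f x * partial i f x).
    by apply/funext => y; apply: eq_bigr => i _; rewrite !mxE.
  apply: (@continuous_sum_ord _ _ (fun i x => partial i f x * partial i f x)) => i y.
  exact: (cvgM (cf i y) (cf i y)).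
exact: (continuous_comp (c1 x) (@sqrt_continuous R _)).
Qed.

End euclidean_norm.

Section entropy_box.
Context {R : realType} {d : nat}.
Variables (V V0 V1 p : 'rV[R]_d -> R) (mu : probability 'rV[R]_d R).
Hypothesis hV : forall x, V x = V0 x + V1 x.
Hypothesis hV0 : convex_function [set: convex_lmodType 'rV[R]_d] V0.
Hypothesis hV1 : continuously_differentiable 1 V1.
Hypothesis hmu : forall A : set 'rV[R]_d, measurable A ->
  mu A = (\int[lebesgue_rV d]_(x in A) (expR (- V x))%:E)%E.
Variables (eps M : R).
Hypothesis eps0 : 0 < eps.
Hypothesis mgap : measurable_fun setT (fun x => expeR ((1 + eps)%:E * legendre_gap V1 p x))%E.
Hypothesis gapM : (\int[mu]_x expeR ((1 + eps)%:E * legendre_gap V1 p x) <= M%:E)%E.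
Variables (E : set 'rV[R]_d) (R0 N : R).
Hypotheses (mE : measurable E) (EB : E `<=` box R0) (R00 : 0 <= R0).
Hypothesis (pN : forall y, E y -> p y <= N).
Hypothesis muE0 : (0 < mu E)%E.
Variables (alpha eta Eeta : R).
Hypotheses (halpha : 1 < alpha <= 2) (eta0 : 0 < eta).
Hypothesis hexp : (\int[mu]_x (expR (eta * enorm x `^ alpha))%:E <= Eeta%:E)%E.

Definition energy (f : 'rV[R]_d -> R) m x : R :=
  enorm (grad f x) ^+ 2 * (ln (expR 1 + f x ^+ 2 / m)) `^ (2 / alpha - 1) / m.

Lemma energy_ge0 f m x : 0 < m -> 0 <= energy f m x.
Proof. by move=> m0; exact: divr_ge0 (mulr_ge0 (sqr_ge0 _) (powR_ge0 _ _)) (ltW m0). Qed.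

Lemma measurable_energy f m : continuously_differentiable 1 f ->
  measurable_fun setT (energy f m).
Proof.
move=> hf; have mf : measurable_fun setT f.
  by apply: continuous_measurable_rV; exact: C1_continuous.
have mln : measurable_fun setT (fun x => ln (expR 1 + f x ^+ 2 / m)).
  apply: measurableT_comp; first exact: measurable_ln.
  apply: measurable_funD => //; apply: measurable_funM => //.
  exact: measurable_funX.
have mP := measurableT_comp (@measurable_powR R (2 / alpha - 1)) mln.
apply: measurable_funM => //; apply: measurable_funM => //.
by apply: measurable_funX; exact: measurable_enorm_grad.
Qed.

(** [core_inequality] for e^g = (s + 1) / Z, where s = f^2 / m and Z <= 2 is the
    integral of s + 1 over the box.  Adding 1 to s makes ln (s + 1) a nonnegative
    C^1 function of x and changes the integrals by bounded amounts only.  The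
    constants depend neither on f nor on the box. *)
Lemma entropy_box : exists C7 C8 : R, [/\ 0 <= C7, 0 < C8 &
  forall f m r, continuously_differentiable 1 f -> 0 < m ->
    (\int[mu]_x (f x ^+ 2)%:E = m%:E)%E -> R0 <= r ->
    (\int[mu]_(x in box r) ((f x ^+ 2 / m + 1) * ln (f x ^+ 2 / m + 1))%:E <=
     C7%:E + C8%:E * \int[mu]_x (energy f m x)%:E)%E].
Proof.
pose kappa := eps / (1 + eps).
have kappa0 : 0 < kappa by rewrite divr_gt0// addr_gt0.
have k20 : 0 < kappa / 2 by rewrite divr_gt0.
have [C5 [C6 [C50 C60 young]]] := young_log halpha eta0 R00 k20 (ler0n R d).
pose C1 := (M - 1) / (1 + eps) + N; pose A := fine (mu E).
have Eeta0 : 0 <= Eeta.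
  rewrite -lee_fin; apply: le_trans hexp; apply: integral_ge0 => x _.
  by rewrite lee_fin expR_ge0.
exists (2 / kappa * (3 * kappa + 2 * `|ln A - C1| + C5 * Eeta)), (2 / kappa * C6); split.
- apply: mulr_ge0; first by rewrite divr_ge0// ltW.
  apply: addr_ge0; last exact: mulr_ge0 (ltW C50) Eeta0.
  by apply: addr_ge0; [exact: mulr_ge0 _ (ltW kappa0)|exact: mulr_ge0].
- by apply: mulr_gt0 => //; rewrite divr_gt0.
move=> f m r hf m0 fm R0r.
pose s x := f x ^+ 2 / m.
have s0 x : 0 <= s x by rewrite divr_ge0 ?sqr_ge0// ltW.
have s10 x : 0 < s x + 1 by rewrite ltr_wpDl.
have cf := C1_continuous hf.
have cs1 : continuous (fun x => s x + 1).
  have -> : (fun x => s x + 1) = (fun x => f x * f x / m + 1) by [].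
  move=> x; have c1 := cf x.
  exact: (cvgD (cvgM (cvgM c1 c1) (cvg_cst m^-1)) (cvg_cst (1 : R))).
have mbox : measurable (@box R d r) by exact: box_measurable.
have is1 := integrable_box mu r cs1.
have Zfin := integrable_fin_num mbox is1.
pose Z := fine (\int[mu]_(x in box r) (s x + 1)%:E).
have ZE : (\int[mu]_(x in box r) (s x + 1)%:E = Z%:E)%E by rewrite fineK.
have ms1 : measurable_fun setT (fun x => (s x + 1)%:E).
  by apply/measurable_EFinP; exact: continuous_measurable_rV.
have mf2 : measurable_fun setT (fun x => (f x ^+ 2)%:E).
  by apply/measurable_EFinP; apply: measurable_funX; exact: continuous_measurable_rV.
have s1ge0 x : (0 <= (s x + 1)%:E)%E by rewrite lee_fin ltW.
have Z2 : Z <= 2.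
  rewrite -lee_fin -ZE.
  apply: (@le_trans _ _ (\int[mu]_x (s x + 1)%:E)%E).
    exact: ge0_subset_integral.
  have -> : (\int[mu]_x (s x + 1)%:E =
      \int[mu]_x ((f x ^+ 2)%:E * m^-1%:E) + \int[mu]_x 1)%E.
    rewrite -ge0_integralD//.
    - by move=> x _; rewrite -EFinM lee_fin s0.
    - by apply: emeasurable_funM.
  rewrite ge0_integralZr ?lee_fin ?invr_ge0 ?(ltW m0)//; last first.
    by move=> x _; rewrite lee_fin sqr_ge0.
  rewrite fm -EFinM divff ?gt_eqF// integral_cst; last exact: measurableT.
  rewrite mul1e; apply: (@le_trans _ _ (1%E + 1%E)%E).
    by rewrite leeD2l//; exact: probability_le1.
  by rewrite -EFinD lee_fin; lra.
have Z0 : 0 < Z.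
  rewrite -lte_fin -ZE; apply: (lt_le_trans muE0).
  apply: (@le_trans _ _ (\int[mu]_(x in box r) 1)%E).
    rewrite integral_cst// mul1e; apply: le_measure; rewrite ?inE//.
    by move=> x /EB xR0 i; exact: le_trans (xR0 i) R0r.
  apply: ge0_le_integral => //; first exact: measurable_funTS.
  by move=> x _; rewrite lee_fin lerDr.
pose phi y := ln (y ^+ 2 / m + 1) - ln Z.
pose phi' y := 2 * y / m / (y ^+ 2 / m + 1).
have dphi y : is_derive y (1 : R) phi (phi' y) by exact: is_derive_ln_sqr.
have cphi' : continuous phi'.
  have pos y : 0 < y ^+ 2 / m + 1 by rewrite ltr_wpDl// divr_ge0 ?sqr_ge0// ltW.
  have -> : phi' = (fun y => 2 * y * m^-1 * (y * y * m^-1 + 1)^-1) by [].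
  move=> y; have cy : (@id R) z @[z --> y] --> y by exact: cvg_id.
  have c1 : (z * z * m^-1 + 1) @[z --> y] --> (y * y * m^-1 + 1 : R).
    exact: (cvgD (cvgM (cvgM cy cy) (cvg_cst m^-1)) (cvg_cst (1 : R))).
  have c2 : (2 * z * m^-1) @[z --> y] --> (2 * y * m^-1 : R).
    exact: (cvgM (cvgM (cvg_cst (2 : R)) cy) (cvg_cst m^-1)).
  have nz : y * y * m^-1 + 1 != 0 := lt0r_neq0 (pos y).
  exact: (cvgM c2 (cvgV nz c1)).
pose g := phi \o f.
have [hg pg] := continuously_differentiable1_comp dphi cphi' hf.
rewrite -/g in hg pg.
have egE x : expR (g x) = (s x + 1) / Z.
  by rewrite /g /= /phi -/(s x) expRD expRN !lnK ?posrE.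
have g1 : (\int[mu]_(x in box r) (expR (g x))%:E = 1)%E.
  have -> : (\int[mu]_(x in box r) (expR (g x))%:E =
      \int[mu]_(x in box r) ((s x + 1)%:E * Z^-1%:E))%E.
    by apply: eq_integral => x _; rewrite egE EFinM.
  rewrite ge0_integralZr ?lee_fin ?invr_ge0 ?(ltW Z0)//; last exact: measurable_funTS.
  by rewrite ZE -EFinM divff ?gt_eqF.
have core := core_inequality hV hV0 hV1 hmu eps0 mgap gapM mE EB R0r pN hg g1 muE0.
have driftle x : Z * (expR (g x) * drift R0 g x) <=
    2 * d%:R * (`|f x| / m) * enorm (grad f x) * (enorm x + R0).
  set q := enorm (grad f x).
  have ZgE c : Z * (expR (g x) * (phi' (f x) * c)) = 2 * f x / m * c.
    by rewrite egE /phi' -/(s x); field; rewrite !gt_eqF.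
  have ZgE' c : Z * (expR (g x) * (`|phi' (f x)| * c)) = 2 * `|f x| / m * c.
    rewrite egE /phi' -/(s x) !normrM !normfV normr_nat (gtr0_norm m0) (gtr0_norm (s10 x)).
    by field; rewrite !gt_eqF.
  have -> : drift R0 g x = phi' (f x) * dotprod (grad f x) x +
      `|phi' (f x)| * (R0 * \sum_i `|partial i f x|).
    rewrite /drift; congr (_ + _).
      by rewrite /dotprod mulr_sumr; apply: eq_bigr => i _; rewrite !mxE pg mulrA.
    rewrite [RHS]mulrCA [in RHS]mulr_sumr; congr (_ * _); apply: eq_bigr => i _.
    by rewrite pg normrM.
  rewrite !mulrDr ZgE ZgE'.
  have fm0 : 0 <= 2 * `|f x| / m by rewrite divr_ge0 ?mulr_ge0// ltW.
  have -> : 2 * d%:R * (`|f x| / m) * q * enorm x + 2 * d%:R * (`|f x| / m) * q * R0 =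
    2 * `|f x| / m * (d%:R * q * enorm x) + 2 * `|f x| / m * (R0 * (d%:R * q)) by ring.
  apply: lerD.
    apply: le_trans (ler_norm _) _; rewrite normrM.
    have -> : `|2 * f x / m| = 2 * `|f x| / m.
      by rewrite !normrM normfV normr_nat (gtr0_norm m0).
    by rewrite ler_wpM2l// dotprod_le_enorm.
  rewrite ler_wpM2l// ler_wpM2l//.
  have := sum_coord_le_enorm (grad f x); rewrite -/q.
  by under eq_bigr do rewrite mxE.
have lnZ : ln Z <= 1.
  have : ln (1 + (Z - 1)) <= Z - 1 by apply: le_ln1Dx; lra.
  by rewrite subrKC; lra.
pose X x := (s x + 1) * ln (s x + 1).
have pointwise x : kappa / 2 * X x + Z * (expR (g x) * tilt eps R0 g x) <=
    3 / 2 * kappa * (s x + 1) + C5 * expR (eta * enorm x `^ alpha) + C6 * energy f m x.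
  have yl := young m (f x) (enorm (grad f x)) (enorm x) m0 (enorm_ge0 _) (enorm_ge0 _).
  have := le_trans (driftle x) yl; rewrite /= -/(s x) -/(energy f m x) -/(X x) => dl.
  have -> : Z * (expR (g x) * tilt eps R0 g x) =
      Z * (expR (g x) * drift R0 g x) - kappa * X x + kappa * (s x + 1) * ln Z.
    rewrite /tilt -/kappa egE /X /g /= /phi -/(s x); field.
    by rewrite gt_eqF.
  have : kappa * (s x + 1) * ln Z <= kappa * (s x + 1).
    by rewrite ler_piMr// mulr_ge0// ltW.
  lra.
have cX : continuous X.
  move=> x; apply: (cvgM (cs1 x)); apply: (continuous_comp (cs1 x)).
  exact: continuous_ln.
have cexpg : continuous (expR \o g).
  by move=> x; apply: continuous_comp; [exact: C1_continuous|exact: continuous_expR].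
have cT : continuous (fun x => expR (g x) * tilt eps R0 g x).
  by move=> x; exact: (cvgM (cexpg x) (@continuous_tilt _ _ eps R0 g hg x)).
have iX := integrable_box mu r cX.
have iT := integrable_box mu r cT.
have Xfin := integrable_fin_num mbox iX; have Tfin := integrable_fin_num mbox iT.
rewrite -(fineK Tfin) in core; rewrite -(fineK Xfin).
set J := fine (\int[mu]_(x in box r) _) in core; set Phi := fine _.
rewrite -EFinD lee_fin -/C1 -/A in core.
set Q := (\int[mu]_x (energy f m x)%:E)%E.
have Q0 : (0 <= Q)%E.
  by apply: integral_ge0 => x _; rewrite lee_fin energy_ge0.
have men := measurable_energy m hf.
have total : ((kappa / 2 * Phi + Z * J)%:E <=
    (3 * kappa + C5 * Eeta)%:E + C6%:E * Q)%E.
  have i1 := integrableZl mbox (kappa / 2) iX.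
  have i2 := integrableZl mbox Z iT.
  have -> : ((kappa / 2 * Phi + Z * J)%:E = \int[mu]_(x in box r)
      ((kappa / 2)%:E * (X x)%:E + Z%:E * (expR (g x) * tilt eps R0 g x)%:E))%E.
    apply/esym; apply: etrans; first exact (integralD mbox i1 i2).
    by rewrite !integralZl// EFinD !EFinM /J /Phi !fineK.
  have mexp : measurable_fun setT (fun x : 'rV[R]_d => (expR (eta * enorm x `^ alpha))%:E).
    apply/measurable_EFinP; apply: measurableT_comp => //; apply: measurable_funM => //.
    exact: (measurableT_comp (@measurable_powR R alpha) (@measurable_enorm R d)).
  have exp0 (x : 'rV[R]_d) : (0 <= (expR (eta * enorm x `^ alpha))%:E)%E.
    by rewrite lee_fin expR_ge0.
  have en0 x : (0 <= (energy f m x)%:E)%E by rewrite lee_fin energy_ge0.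
  have mEn : measurable_fun setT (fun x => (energy f m x)%:E) by exact/measurable_EFinP.
  have k0 : (0 <= (3 / 2 * kappa)%:E)%E.
    by rewrite lee_fin mulr_ge0 ?(ltW kappa0).
  have C5e : (0 <= C5%:E)%E by rewrite lee_fin ltW.
  have C6e : (0 <= C6%:E)%E by rewrite lee_fin ltW.
  have mK (h : 'rV[R]_d -> \bar R) (c : R) : measurable_fun setT h ->
      measurable_fun (box r) (fun x => c%:E * h x)%E.
    by move=> mh; apply: measurable_funTS; exact: emeasurable_funM.
  apply: (@le_trans _ _ (\int[mu]_(x in box r) ((3 / 2 * kappa)%:E * (s x + 1)%:E +
      C5%:E * (expR (eta * enorm x `^ alpha))%:E + C6%:E * (energy f m x)%:E))%E).
    apply: ge0_le_integral_semi => //.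
    - apply: emeasurable_funD; apply: mK; apply/measurable_EFinP.
        exact: continuous_measurable_rV.
      exact: continuous_measurable_rV.
    - by apply: emeasurable_funD; [apply: emeasurable_funD|]; exact: mK.
    - by move=> x _; rewrite !adde_ge0// mule_ge0.
    - by move=> x _; rewrite -!EFinM -!EFinD lee_fin.
  have m1 := mK _ (3 / 2 * kappa) ms1; have m2 := mK _ C5 mexp; have m3 := mK _ C6 mEn.
  have m12 := emeasurable_funD m1 m2.
  have n1 x : box r x -> (0 <= (3 / 2 * kappa)%:E * (s x + 1)%:E)%E by rewrite mule_ge0.
  have n2 (x : 'rV[R]_d) : box r x ->
      (0 <= C5%:E * (expR (eta * enorm x `^ alpha))%:E)%E by rewrite mule_ge0.
  have n3 x : box r x -> (0 <= C6%:E * (energy f m x)%:E)%E by rewrite mule_ge0.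
  have n12 (x : 'rV[R]_d) : box r x -> (0 <= (3 / 2 * kappa)%:E * (s x + 1)%:E +
      C5%:E * (expR (eta * enorm x `^ alpha))%:E)%E.
    by move=> bx; rewrite adde_ge0// ?n1// n2.
  rewrite (ge0_integralD _ mbox n12 m12 n3 m3) (ge0_integralD _ mbox n1 m1 n2 m2).
  rewrite !ge0_integralZl//; try exact: measurable_funTS.
  have subT (h : 'rV[R]_d -> \bar R) : measurable_fun setT h -> (forall x, 0 <= h x)%E ->
      (\int[mu]_(x in box r) h x <= \int[mu]_x h x)%E.
    by move=> mh h0; exact: ge0_subset_integral.
  apply: leeD; last by rewrite lee_wpmul2l// subT.
  rewrite EFinD; apply: leeD; last first.
    by rewrite EFinM lee_wpmul2l//; apply: le_trans hexp; exact: subT.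
  rewrite ZE -EFinM lee_fin.
  have : kappa * Z <= kappa * 2 by rewrite ler_pM2l.
  lra.
have [Qy|Qfin] := eqVneq Q +oo%E.
  have C80 : 0 < 2 / kappa * C6 by apply: mulr_gt0 => //; rewrite divr_gt0.
  by rewrite Qy gt0_muley ?lte_fin// addey// leey.
have {}Qfin : Q \is a fin_num by rewrite ge0_fin_numE// ltey.
move: total; rewrite -(fineK Qfin) -!EFinM -!EFinD !lee_fin => total.
have ZJ : - (2 * `|ln A - C1|) <= Z * J.
  have := ler_norm (- (ln A - C1)); rewrite normrN => h.
  have n0 := normr_ge0 (ln A - C1).
  have : Z * (- `|ln A - C1|) <= Z * J by rewrite ler_pM2l//; lra.
  have : Z * `|ln A - C1| <= 2 * `|ln A - C1| by rewrite ler_wpM2r.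
  lra.
have -> : Phi = 2 / kappa * (kappa / 2 * Phi) by field; rewrite gt_eqF.
have -> : 2 / kappa * (3 * kappa + 2 * `|ln A - C1| + C5 * Eeta) + 2 / kappa * C6 * fine Q =
  2 / kappa * (3 * kappa + 2 * `|ln A - C1| + C5 * Eeta + C6 * fine Q) by ring.
apply: ler_wpM2l; first by rewrite divr_ge0// ltW.
lra.
Qed.

End entropy_box.

(** * Exhaustion by boxes and the theorem *)

Section exhaustion.
Context {R : realType} {d : nat}.

Lemma bigcup_box : \bigcup_n (box n%:R : set 'rV[R]_d) = setT.
Proof.
apply/seteqP; split=> // x _.
exists (Num.bound (\sum_i `|x ord0 i|)) => // i.
apply: ltW; apply: le_lt_trans (archi_boundP _); last by rewrite sumr_ge0.
by rewrite (bigD1 i)//= lerDl sumr_ge0.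
Qed.

Lemma box_le (r r' : R) : r <= r' -> (box r : set 'rV[R]_d) `<=` box r'.
Proof. by move=> rr x bx i; exact: le_trans (bx i) rr. Qed.

Lemma ge0_integral_le_boxes (mu : {measure set 'rV[R]_d -> \bar R})
    (f : 'rV[R]_d -> \bar R) (C : \bar R) (R0 : R) :
  measurable_fun setT f -> (forall x, 0 <= f x)%E ->
  (forall r, R0 <= r -> (\int[mu]_(x in box r) f x <= C)%E) ->
  (\int[mu]_x f x <= C)%E.
Proof.
move=> mf f0 fC; pose g n : 'rV[R]_d -> \bar R := f \_ (box n%:R).
have mg n : measurable_fun setT (g n).
  apply/(measurable_restrictT _ _).1; first exact: box_measurable.
  exact: measurable_funTS.
have g0 n x : setT x -> (0 <= g n x)%E by move=> _; exact: erestrict_ge0.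
have gmono x : setT x -> {homo (g ^~ x) : n k / (n <= k)%N >-> (n <= k)%E}.
  move=> _ n k nk; rewrite /g !patchE; case: ifPn => [/set_mem bx|_].
    by rewrite mem_set//; apply: box_le bx; rewrite ler_nat.
  by case: ifPn.
have glim x : g n x @[n --> \oo] --> f x.
  have [n0 _ bx] : (\bigcup_n (box n%:R : set 'rV[R]_d)) x by rewrite bigcup_box.
  apply: cvg_near_cst; exists n0 => // n /= n0n.
  by rewrite /g patchE mem_set//; apply: box_le bx; rewrite ler_nat.
have -> : (\int[mu]_x f x = limn (fun n => \int[mu]_x g n x))%E.
  rewrite -monotone_convergence//.
  by apply: eq_integral => x _; apply/esym/cvg_lim => //; exact: glim.
apply: lime_le.
  apply: ereal_nondecreasing_is_cvgn => n k nk; apply: ge0_le_integral => //.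
  - by move=> x _; exact: g0.
  - by move=> x _; exact: gmono.
near=> n; rewrite /g -integral_mkcond; apply: fC.
by near: n; exact: nbhs_infty_ger.
Unshelve. all: by end_near. Qed.

(** The sets of points of [box n] where p <= n exhaust the space, so they cannot
    all be negligible. *)
Lemma positive_sublevel (mu : probability 'rV[R]_d R) (p : 'rV[R]_d -> R) :
  measurable_fun setT p ->
  exists (n : nat) (E : set 'rV[R]_d), [/\ measurable E, E `<=` box n%:R,
    forall x, E x -> p x <= n%:R & (0 < mu E)%E].
Proof.
move=> mp; pose E n : set 'rV[R]_d := box n%:R `&` [set x | p x <= n%:R]%R.
have mE n : measurable (E n).
  apply: measurableI; first exact: box_measurable.
  rewrite -[X in measurable X]setTI (_ : [set x | _] = p @^-1` `]-oo, n%:R]%classic).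
    exact: mp.
  by apply/seteqP; split=> x; rewrite /= in_itv.
have [[n En]|H] := pselect (exists n, (0 < mu (E n))%E).
  by exists n, (E n); split=> // x [].
have E0 n : mu (E n) = 0%E.
  apply/eqP; rewrite eq_le measure_ge0 andbT leNgt.
  by apply/negP => En; apply: H; exists n.
have ET : \bigcup_n E n = setT.
  apply/seteqP; split=> // x _.
  have [n _ bx] : (\bigcup_n (box n%:R : set 'rV[R]_d)) x by rewrite bigcup_box.
  pose k := Num.bound `|p x|; exists (maxn n k) => //; split.
    by apply: box_le bx; rewrite ler_nat leq_maxl.
  rewrite /=; apply: (le_trans (ler_norm _)); apply: (@le_trans _ _ k%:R).
    by apply: ltW; exact: archi_boundP.
  by rewrite ler_nat leq_maxr.
have Tsub : setT `<=` \bigcup_n E n by rewrite ET.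
have := measure_sigma_subadditive mu mE measurableT Tsub.
rewrite eseries0 => [|n _ _]; last exact: E0.
rewrite [X in (X <= _)%E -> _](_ : _ = 1%E); last exact: probability_setT.
by rewrite lee_fin ler10.
Qed.

End exhaustion.

Theorem theorem5p24 (R : realType) (d : nat) (alpha alphas : R)
  (halpha : 1 < alpha <= 2)
  (halphas : alpha^-1 + alphas^-1 = 1)
  (V V0 V1 : 'rV[R]_d -> R)
  (hV : forall x, V x = V0 x + V1 x)
  (hV0 : convex_function [set: convex_lmodType 'rV[R]_d] V0)
  (hV1 : continuously_differentiable 1 V1)
  (mu : probability 'rV[R]_d R)
  (hmu : forall A : set 'rV[R]_d, measurable A ->
     mu A = (\int[lebesgue_rV d]_(x in A) (expR (- V x))%:E)%E)
  (hp : exists (p : 'rV[R]_d -> R) (eps : R),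
     [/\ mu.-integrable setT (fun x => (p x)%:E),
         0 < eps &
         mu.-integrable setT (fun x =>
           expeR ((1 + eps)%:E *
             ((V1 x - dotprod x (grad V1 x))%:E
              + legendre (V1 \+ p)%R (grad V1 x)))%E)])
  (hexp : exists eta : R, 0 < eta /\
     (\int[mu]_x (expR (eta * enorm x `^ alpha))%:E < +oo)%E) :
  inequality_I mu (2 / alphas).
Proof.
have [p [eps [ip eps0 igap]]] := hp; have [eta [eta0 etaoo]] := hexp.
have mp : measurable_fun setT p.
  by apply/measurable_EFinP; exact: measurable_int ip.
have [n [E [mE EB pN mun]]] := positive_sublevel mu mp.
have [mgap _] := integrableP _ _ _ igap.
have gapfin := integrable_fin_num measurableT igap.
pose M := fine (\int[mu]_x expeR ((1 + eps)%:E * legendre_gap V1 p x))%E.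
have gapM : (\int[mu]_x expeR ((1 + eps)%:E * legendre_gap V1 p x) <= M%:E)%E.
  by rewrite fineK.
pose Eeta := fine (\int[mu]_x (expR (eta * enorm x `^ alpha))%:E)%E.
have hEeta : (\int[mu]_x (expR (eta * enorm x `^ alpha))%:E <= Eeta%:E)%E.
  rewrite fineK// ge0_fin_numE//; apply: integral_ge0 => x _.
  by rewrite lee_fin expR_ge0.
have [C7 [C8 [C70 C80 main]]] := entropy_box hV hV0 hV1 hmu eps0 mgap gapM mE EB
  (ler0n R n) pN mun halpha eta0 hEeta.
have tauE : 1 - 2 / alphas = 2 / alpha - 1.
  have -> : alphas^-1 = 1 - alpha^-1 by rewrite -halphas; lra.
  lra.
exists C7, C8 => f sf f2 m moo.
have hf : continuously_differentiable 1 f := sf 1%N.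
have mf : measurable_fun setT f.
  by apply: continuous_measurable_rV; exact: C1_continuous.
have m0 : (0 <= m)%E by apply: integral_ge0 => x _; rewrite lee_fin sqr_ge0.
have mfin : m \is a fin_num by rewrite ge0_fin_numE.
(* if the integral of f^2 vanishes, the integrand of Ent is identically 0 *)
rewrite tauE; have [mz|mnz] := eqVneq (fine m) 0.
  rewrite /Ent -/m integral0_eq; last first.
    by move=> x _; rewrite mz invr0 mulr0 ln0// mulr0.
  rewrite adde_ge0// ?mule_ge0// ?lee_fin// ?(ltW C80)//.
  by apply: integral_ge0 => x _; rewrite lee_fin mulr_ge0 ?sqr_ge0 ?powR_ge0.
have mpos : 0 < fine m by rewrite lt0r mnz fine_ge0.
have mE2 : (\int[mu]_x (f x ^+ 2)%:E = (fine m)%:E)%E by rewrite fineK.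
pose s x := f x ^+ 2 / fine m.
have s0 x : 0 <= s x by rewrite divr_ge0 ?sqr_ge0// ltW.
have ms : measurable_fun setT s.
  by apply: measurable_funM => //; exact: measurable_funX.
have ms1 : measurable_fun setT (fun x => s x + 1) by exact: measurable_funD.
have mX : measurable_fun setT (fun x => (s x + 1) * ln (s x + 1)).
  by apply: measurable_funM => //; apply: measurableT_comp => //; exact: measurable_ln.
have X0 x : 0 <= (s x + 1) * ln (s x + 1).
  by rewrite mulr_ge0 ?ln_ge0 ?lerDr// addr_ge0.
have total : (\int[mu]_x ((s x + 1) * ln (s x + 1))%:E <=
    C7%:E + C8%:E * \int[mu]_x (energy alpha f (fine m) x)%:E)%E.
  apply: (@ge0_integral_le_boxes R d mu _ _ n%:R).
  - exact/measurable_EFinP.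
  - by move=> x; rewrite lee_fin.
  - by move=> r nr; exact: main.
(* s ln s <= (s + 1) ln (s + 1): for s <= 1 the left-hand side is nonpositive *)
apply: (@le_trans _ _ ((fine m)%:E * \int[mu]_x ((s x + 1) * ln (s x + 1))%:E)%E).
  rewrite -ge0_integralZl//; last 3 first.
  - exact/measurable_EFinP.
  - by move=> x _; rewrite lee_fin.
  - by rewrite lee_fin ltW.
  apply: ge0_le_integral_semi => //.
  - apply/measurable_EFinP; apply: measurable_funM; first exact: measurable_funX.
    by apply: measurableT_comp => //; exact: measurable_ln.
  - by apply: emeasurable_funM => //; exact/measurable_EFinP.
  - by move=> x _; apply: mule_ge0; rewrite lee_fin; [exact: ltW|exact: X0].
  move=> x _; rewrite -EFinM lee_fin -/(s x).
  have -> : f2 x = fine m * s x by rewrite /s mulrC divfK.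
  rewrite -mulrA ler_wpM2l ?(ltW mpos)//.
  have [s1|s1] := leP (s x) 1.
    by apply: (le_trans _ (X0 x)); rewrite mulr_ge0_le0// ln_le0.
  apply: ler_pM => //; first by rewrite ln_ge0// ltW.
    by rewrite lerDl.
  by rewrite ler_ln ?posrE ?lerDl// ?ltr_wpDl// (lt_trans _ s1).
apply: (@le_trans _ _ ((fine m)%:E * (C7%:E +
    C8%:E * \int[mu]_x (energy alpha f (fine m) x)%:E))%E).
  by rewrite lee_wpmul2l// lee_fin ltW.
have en0 x : 0 <= energy alpha f (fine m) x by exact: energy_ge0.
have mEn := measurable_energy alpha (fine m) hf.
rewrite ge0_muleDr ?lee_fin ?mule_ge0 ?lee_fin ?(ltW C80)//; last first.
  by apply: integral_ge0 => x _; rewrite lee_fin.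
apply: leeD; first by rewrite muleC fineK.
rewrite muleCA lee_wpmul2l ?lee_fin ?(ltW C80)// -ge0_integralZl//; last 3 first.
- exact/measurable_EFinP.
- by move=> x _; rewrite lee_fin.
- by rewrite lee_fin ltW.
rewrite le_eqVlt; apply/orP; left; apply/eqP; apply: eq_integral => x _.
by rewrite -EFinM /energy mulrC divfK.
Qed.
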